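(* Let $n\ge1$. For $h,k\ge0$ let $\alpha_n(h,k)$ be the number of ad-nilpotent ideals in $\mathcal I^n$ with dimension $h$ and class of nilpotence $k$, and let $$C_n(q,t)=\sum_{h,k\ge0}\alpha_n(h,k)\,t^hq^k .$$ Then $$C_n(q,t)=\sum_{k=0}^n\left(\sum_{0=i_0<i_1<\dots<i_k<i_{k+1}=n+1}\ \prod_{j=0}^{k-1}t^{\,i_{j+1}(i_{j+3}-i_{j+2})}\begin{bmatrix}i_{j+2}-i_j-1\\ i_{j+1}-i_j\end{bmatrix}_t\right)q^k,$$ where $i_{k+2}=n+2$. Moreover, $C_n(q,1)$ is the generating function for Dyck paths from $(0,0)$ to $(2n+2,0)$ counted with respect to height, in the sense that $$C_n(q,1)=\sum_{P}q^{\,\mathrm{height}(P)-1},$$ and $C_n(1,t)$ is the generating function for the same set of Dyck paths with respect to the weight function $(n+1)^2/2-A(\cdot)$, i.e. $$C_n(1,t)=\sum_P t^{(n+1)^2/2-A(P)},$$ both sums being over all Dyck paths $P$ from $(0,0)$ to $(2n+2,0)$.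
   Context: Let $\mathfrak g=sl(n+1,\mathbb C)$ with a fixed Cartan subalgebra $\mathfrak h$, positive roots $\Delta^+$, root spaces $\mathfrak g_\alpha$, and Borel subalgebra $\mathfrak b=\mathfrak h\oplus\bigoplus_{\alpha\in\Delta^+}\mathfrak g_\alpha$. $\mathcal I^n$ is the set of ad-nilpotent ideals of $\mathfrak b$, i.e. ideals of $\mathfrak b$ consisting of ad-nilpotent elements. For $\mathfrak i\in\mathcal I^n$ put $\mathfrak i^1=\mathfrak i$, $\mathfrak i^{m}=[\mathfrak i^{m-1},\mathfrak i]$. The class of nilpotence of $\mathfrak i$ is the smallest $m\ge0$ with $\mathfrak i^{m+1}=0$ (so the zero ideal has class $0$, and Abelian ideals are exactly those of class at most $1$). The $t$-binomial coefficient is $\begin{bmatrix}m\\ n\end{bmatrix}_t=\frac{[m]!}{[m-n]!\,[n]!}$ if $m\ge n>0$, it is $1$ if $n=0$, and $0$ in any other case, where $[m]!=[m][m-1]\cdots[1]$, $[0]!=1$, $[i]=(t^i-1)/(t-1)$. The empty product is $1$. A Dyck path from $(0,0)$ to $(2N,0)$ is a lattice path with step vectors $(1,1)$ and $(1,-1)$ which does not pass below the $x$-axis; its height is the maximum ordinate of its peaks. $A(P)$ is the area of the region between $P$ and the $x$-axis, measured in the unit in which the square spanned by the two step vectors $(1,1)$ and $(1,-1)$ has area $1$ (i.e. $A(P)$ is half of the Euclidean area in the coordinates used for the steps). *)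

(* Defs.v *)
From HB Require Import structures.
From mathcomp Require Import all_boot all_order all_algebra.
From mathcomp Require Import complex.
From mathcomp Require Import finmap.
From mathcomp Require Import boolp classical_sets cardinality reals.

Set Implicit Arguments.
Unset Strict Implicit.
Unset Printing Implicit Defensive.

Import GRing.Theory Num.Theory.

Local Open Scope ring_scope.

Definition lie_bracket (F : fieldType) (n : nat) (X Y : 'M[F]_n) : 'M[F]_n :=
  X *m Y - Y *m X.

Fact lie_bracket_is_linear (F : fieldType) (n : nat) (X : 'M[F]_n) :
  linear (lie_bracket X).
Proof.
move=> a Y Z; rewrite /lie_bracket mulmxDr mulmxDl -scalemxAr -scalemxAl.
by rewrite scalerBr opprD addrACA.
Qed.

HB.instance Definition _ (F : fieldType) (n : nat) (X : 'M[F]_n) :=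
  GRing.isLinear.Build F 'M[F]_n 'M[F]_n *:%R (lie_bracket X)
    (lie_bracket_is_linear X).

Definition ad (F : fieldType) (n : nat) (X : 'M[F]_n) : 'End('M[F]_n) :=
  linfun (lie_bracket X).

Lemma adE (F : fieldType) (n : nat) (X Y : 'M[F]_n) :
  ad X Y = lie_bracket X Y.
Proof. exact: lfunE. Qed.

Definition sl (F : fieldType) (n : nat) : {vspace 'M[F]_n} :=
  lker (linfun (@mxtrace F n : 'M[F]_n -> F^o)).

Lemma mem_sl (F : fieldType) (n : nat) (X : 'M[F]_n) :
  (X \in sl F n) = (\tr X == 0).
Proof. by rewrite memv_ker lfunE. Qed.

Definition lie_prod (F : fieldType) (n : nat) (U V : {vspace 'M[F]_n}) :
    {vspace 'M[F]_n} :=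
  <<[seq lie_bracket X Y | X <- vbasis U, Y <- vbasis V]>>%VS.

Lemma mem_lie_prod (F : fieldType) (n : nat) (U V : {vspace 'M[F]_n}) X Y :
  X \in U -> Y \in V -> lie_bracket X Y \in lie_prod U V.
Proof.
move=> /coord_vbasis -> /coord_vbasis ->; rewrite linear_sum /=.
apply: memv_suml => j _; rewrite linearZ /=; apply: memvZ.
rewrite /lie_bracket mulmx_suml mulmx_sumr -sumrB.
apply: memv_suml => i _; rewrite -scalemxAl -scalemxAr -scalerBr.
apply/memvZ/memv_span/allpairsP; exists ((vbasis U)`_i, (vbasis V)`_j).
by split=> //=; apply: mem_nth; rewrite size_tuple ltn_ord.
Qed.

Lemma lie_prod_sub (F : fieldType) (n : nat) (U V W : {vspace 'M[F]_n}) :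
  (forall X Y, X \in U -> Y \in V -> lie_bracket X Y \in W) ->
  (lie_prod U V <= W)%VS.
Proof.
move=> UVW; apply/span_subvP => _ /allpairsP [[X Y] /= [XU YV ->]].
by apply: UVW; apply: vbasis_mem.
Qed.

(** Cartan subalgebras of the semisimple Lie algebra sl: self-centralising
    subspaces (hence maximal Abelian subalgebras) acting diagonalisably on sl
    through the adjoint representation. *)
Definition cartan_subalgebra (F : fieldType) (n : nat)
    (h : {vspace 'M[F]_n}) : Prop :=
  [/\ (h <= sl F n)%VS,
      forall X, X \in sl F n ->
        (X \in h <-> forall H, H \in h -> lie_bracket H X = 0)
    & forall H, H \in h -> exists2 s : seq 'M[F]_n, basis_of (sl F n) s &
        forall X, X \in s -> exists c, lie_bracket H X = c *: X].

Definition root_space (F : fieldType) (n : nat) (h : {vspace 'M[F]_n})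
    (alpha : 'Hom(subvs_of h, F^o)) : {vspace 'M[F]_n} :=
  (sl F n :&: \bigcap_(H <- vbasis {: subvs_of h})
     passmx.leigenspace (ad (vsval H)) (alpha H))%VS.

Lemma root_spaceP (F : fieldType) (n : nat) (h : {vspace 'M[F]_n})
    (alpha : 'Hom(subvs_of h, F^o)) (X : 'M[F]_n) :
  reflect (X \in sl F n /\
           forall H : subvs_of h, lie_bracket (vsval H) X = alpha H *: X)
          (X \in root_space alpha).
Proof.
rewrite memv_cap; apply: (iffP andP) => -[Xsl XH]; split => //.
  have XB i : lie_bracket (vsval (vbasis {: subvs_of h})`_i) X =
              alpha (vbasis {: subvs_of h})`_i *: X.
    have [lti|lei] := ltnP i (size (vbasis {: subvs_of h})); last first.
      by rewrite nth_default // !linear0 scale0r /lie_bracket mul0mx mulmx0 subrr.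
    move: XH; rewrite big_tnth memvE => /subv_bigcapP /(_ (Ordinal lti) isT).
    rewrite -memvE => /eqlfunP; rewrite adE scale_lfunE id_lfunE.
    by rewrite (tnth_nth 0).
  move=> H; rewrite (coord_vbasis (memvf H)) !linear_sum /= scaler_suml.
  rewrite /lie_bracket mulmx_suml mulmx_sumr -sumrB; apply: eq_bigr => i _.
  have -> (c : F) Y : c *: Y *m X - X *m (c *: Y) = c *: lie_bracket Y X.
    by rewrite -scalemxAl -scalemxAr -scalerBr.
  by rewrite XB scalerA linearZ.
rewrite big_tnth memvE; apply/subv_bigcapP => i _.
by rewrite -memvE; apply/eqlfunP; rewrite adE scale_lfunE id_lfunE XH.
Qed.

Definition is_root (F : fieldType) (n : nat) (h : {vspace 'M[F]_n})
    (alpha : 'Hom(subvs_of h, F^o)) : bool :=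
  (alpha != 0) && (root_space alpha != 0%VS).

Definition positive_system (F : fieldType) (n : nat) (h : {vspace 'M[F]_n})
    (Pos : seq 'Hom(subvs_of h, F^o)) : Prop :=
  [/\ forall alpha, alpha \in Pos -> is_root alpha,
      forall alpha, is_root alpha -> (- alpha \in Pos) = (alpha \notin Pos)
    & forall alpha beta, alpha \in Pos -> beta \in Pos ->
        is_root (alpha + beta) -> alpha + beta \in Pos].

Definition borel (F : fieldType) (n : nat) (h : {vspace 'M[F]_n})
    (Pos : seq 'Hom(subvs_of h, F^o)) : {vspace 'M[F]_n} :=
  (h + \sum_(alpha <- Pos) root_space alpha)%VS.

Definition ad_nilpotent (F : fieldType) (n : nat) (X : 'M[F]_n) : Prop :=
  exists m, forall Y, Y \in sl F n -> iter m (lie_bracket X) Y = 0.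

Definition ad_nilpotent_ideal (F : fieldType) (n : nat)
    (b I : {vspace 'M[F]_n}) : Prop :=
  [/\ (I <= b)%VS,
      forall X Y, X \in b -> Y \in I -> lie_bracket X Y \in I
    & forall X, X \in I -> ad_nilpotent X].

(** [ideal_pow I m] is meaningful for m >= 1 only, with [ideal_pow I 1 = I]. *)
Definition ideal_pow (F : fieldType) (n : nat) (I : {vspace 'M[F]_n})
    (m : nat) : {vspace 'M[F]_n} :=
  iter m.-1 (fun J => lie_prod J I) I.

Definition nilpotence_class (F : fieldType) (n : nat) (I : {vspace 'M[F]_n})
    (k : nat) : Prop :=
  ideal_pow I k.+1 = 0%VS /\
  forall m, ideal_pow I m.+1 = 0%VS -> (k <= m)%N.

Definition ideals_of (F : fieldType) (n : nat) (b : {vspace 'M[F]_n})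
    (h k : nat) : set {vspace 'M[F]_n} :=
  [set I | [/\ ad_nilpotent_ideal b I, \dim I = h & nilpotence_class I k]]%classic.

(** [fset_set] is empty on infinite sets; finiteness is part of the theorem. *)
Definition num_ideals (F : fieldType) (n : nat) (b : {vspace 'M[F]_n})
    (h k : nat) : nat :=
  #|` fset_set (ideals_of b h k)|%fset.

(** The t-analogues are polynomials in t = 'X; the Euclidean quotients below
    are exact, see [tintE] and [tbinE]. *)
Definition tint (i : nat) : {poly rat} := ('X^i - 1) %/ ('X - 1).

Definition tfact (m : nat) : {poly rat} := \prod_(1 <= i < m.+1) tint i.

Definition tbin (m n : nat) : {poly rat} :=
  if n == 0%N then 1
  else if (n <= m)%N then tfact m %/ (tfact (m - n) * tfact n)
  else 0.

Lemma tintE (i : nat) : tint i * ('X - 1) = 'X^i - 1.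
Proof. by apply: divpK; rewrite subrX1; apply: dvdp_mulr. Qed.

Lemma tintD (a b : nat) : tint (a + b) = tint a + 'X^a * tint b.
Proof.
have X1 : 'X - 1 != 0 :> {poly rat} by rewrite -polyC1 polyXsubC_eq0.
apply: (mulIf X1); rewrite mulrDl -mulrA !tintE exprD.
by rewrite mulrBr mulr1 [RHS]addrC subrKA.
Qed.

Lemma tfactS (m : nat) : tfact m.+1 = tint m.+1 * tfact m.
Proof. by rewrite /tfact big_nat_recr //= mulrC. Qed.

Lemma dvdp_tfact (a b : nat) : tfact a * tfact b %| tfact (a + b).
Proof.
elim: a b => [|a IHa] b; first by rewrite [tfact 0]big_geq // mul1r.
elim: b => [|b IHb]; first by rewrite [tfact 0]big_geq // mulr1 addn0.
have -> : tfact (a.+1 + b.+1) =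
    tint a.+1 * tfact (a + b.+1) + 'X^(a.+1) * tint b.+1 * tfact (a.+1 + b).
  by rewrite {1}addnS tfactS -[(a.+1 + b).+1]addnS tintD mulrDl addSnnS.
apply: dvdp_add.
  by rewrite (tfactS a) -(mulrA (tint _)); apply: dvdp_mul.
by rewrite (tfactS b) mulrCA -(mulrA 'X^_); apply/dvdp_mull/dvdp_mul.
Qed.

Lemma tbinE (m n : nat) : (n <= m)%N ->
  tbin m n * (tfact (m - n) * tfact n) = tfact m.
Proof.
move=> le_nm; rewrite /tbin le_nm; case: eqP => [->|_].
  by rewrite subn0 mul1r [tfact 0]big_geq // mulr1.
by apply: divpK; rewrite -{2}(subnK le_nm) dvdp_tfact.
Qed.

(** s lists the chain 0 = i_0 < i_1 < ... < i_k < i_{k+1} = n + 1. *)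
Definition is_chain (n k : nat) (s : k.+2.-tuple 'I_n.+2) : bool :=
  [&& thead s == 0%N :> nat, last 0%N (map val s) == n.+1
    & sorted ltn (map val s)].

(** i_j for j <= k + 2, with the additional entry i_{k+2} = n + 2. *)
Definition chain_entry (n k : nat) (s : k.+2.-tuple 'I_n.+2) (j : nat) : nat :=
  nth 0%N (rcons (map val s) n.+2) j.

Definition chain_weight (n k : nat) (s : k.+2.-tuple 'I_n.+2) : {poly rat} :=
  let i := chain_entry s in
  \prod_(j < k) ('X^(i j.+1 * (i j.+3 - i j.+2)) *
                 tbin (i j.+2 - i j - 1) (i j.+1 - i j)).

(** A path is the sequence of its steps, [true] for (1, 1) and [false]
    for (1, -1); [ordinate p m] is its ordinate at abscissa m. *)
Definition ordinate (p : seq bool) (m : nat) : int :=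
  \sum_(s <- take m p) (if s then 1 else -1).

Definition dyck (p : seq bool) : bool :=
  all (fun m => 0 <= ordinate p m) (iota 0 (size p).+1) &&
  (ordinate p (size p) == 0).

Definition is_peak (p : seq bool) (m : nat) : bool :=
  [&& (0 < m)%N, (m < size p)%N, nth false p m.-1 & ~~ nth true p m].

(** Ordinates of a Dyck path are nonnegative, hence the harmless absz. *)
Definition height (p : seq bool) : nat :=
  \max_(m < size p | is_peak p m) `|ordinate p m|%N.

(** Half the Euclidean area below the path, one trapezoid per step. *)
Definition area (p : seq bool) : rat :=
  (\sum_(m < size p) ((ordinate p m)%:~R + (ordinate p m.+1)%:~R) / 2) / 2.

(* Main.v *)
(* Conjugating the Cartan subalgebra to diagonal matrices makes the positive
   system a total order on the indices and the Borel subalgebra the upper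
   triangular one.  Ad with an element of h separating the roots splits an
   ad-nilpotent ideal into root spaces, so an ideal is an up-closed set of
   pairs i < j, i.e. a nondecreasing sequence s with s_j <= j, where s_j is the
   number of root spaces in column j.  Its dimension is the sum of s, and its
   class is the number of steps of m |-> s_(m-1) from n + 1 to 0, minus 1.
   Cutting s at the values met on the way gives the chains of the formula, each
   block of s being counted by one t-binomial.
   The numbers j - s_j are the ordinates at which the up steps of a Dyck path
   start, which gives the area statement.  For the height, deleting the steps
   that start at ordinate 0 gives the same recursion at t = 1 as deleting the
   last block of s. *)
Require Import Defs.
From HB Require Import structures.
From mathcomp Require Import all_boot all_order all_algebra.
From mathcomp Require Import complex.
From mathcomp Require Import finmap.
From mathcomp Require Import boolp classical_sets cardinality reals.
From mathcomp Require Import fingroup perm zify ring.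

Set Implicit Arguments.
Unset Strict Implicit.
Unset Printing Implicit Defensive.

Import Order.TTheory GRing.Theory Num.Theory.

Local Open Scope ring_scope.

(** * Column sequences of ideals *)

(** The Dyck path that gives the area does not give the height: for s = 0 its up steps start at 0,
    1, ..., n, so it is the highest path, while the class is 0. The height statement is therefore an
    equality of distributions, proved without a bijection that matches class with height. The class
    alone satisfies no recursion, because the number of ways to append a block to s depends on the
    last entry of s. A second statistic is carried along, through an arbitrary function [phi] of it.
    It is the last entry of s for ideals, the last entry but one for chains, and the number of up
    steps starting above the axis for paths. The chain formula and the height statement then come
    from the same kind of induction, with weights t-binomial in one case and binomial in the other.
    All families are explicit duplicate-free lists, so a decomposition becomes an identity of sums
    once both lists are known to have the same members. *)

Lemma tint_neq0 i : (0 < i)%N -> tint i != 0.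
Proof.
move=> i_gt0; apply/eqP => ti0; have := tintE i; rewrite ti0 mul0r => /esym/eqP.
by rewrite -size_poly_eq0 -polyC1 size_XnsubC.
Qed.

Lemma tfact_neq0 m : tfact m != 0.
Proof.
rewrite /tfact big_nat_cond prodf_seq_neq0; apply/allP => i _.
by apply/implyP => /andP[/andP[? _] _]; exact: tint_neq0.
Qed.

Lemma tbin0 m : tbin m 0 = 1. Proof. by []. Qed.

Lemma tbinDE a b : tbin (a + b) b * (tfact a * tfact b) = tfact (a + b).
Proof. by have := @tbinE (a + b) b (leq_addl _ _); rewrite addnK. Qed.

Lemma tbin_sym a b : tbin (a + b) a = tbin (a + b) b.
Proof.
apply: (mulIf (mulf_neq0 (tfact_neq0 a) (tfact_neq0 b))).
by rewrite tbinDE addnC [X in _ * X]mulrC tbinDE.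
Qed.

Lemma tbinn a : tbin a a = 1.
Proof. by rewrite -[in LHS](add0n a) -tbin_sym. Qed.

(** Once the factorials are cleared, this is [tintD] applied to the sum of a + 1 and b + 1. *)
Lemma tbin_pascal a b :
  tbin (a.+1 + b.+1) b.+1 = tbin (a + b.+1) b.+1 + 'X^(a.+1) * tbin (a.+1 + b) b.
Proof.
apply: (mulIf (mulf_neq0 (tfact_neq0 a.+1) (tfact_neq0 b.+1))).
rewrite tbinDE mulrDl.
have -> : tbin (a + b.+1) b.+1 * (tfact a.+1 * tfact b.+1) =
    tint a.+1 * tfact (a + b.+1).
  by rewrite tfactS -(mulrA (tint _)) mulrCA tbinDE.
have -> : 'X^(a.+1) * tbin (a.+1 + b) b * (tfact a.+1 * tfact b.+1) =
    'X^(a.+1) * tint b.+1 * tfact (a + b.+1).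
  rewrite (tfactS b) (mulrCA (tfact a.+1)) -mulrA (mulrCA (tbin _ _)) tbinDE.
  by rewrite mulrA addSnnS.
by rewrite -mulrDl -tintD addSn tfactS -addSn.
Qed.

(** Nondecreasing sequences in [lo, lo + d] are split on whether the first entry equals lo, which is
    the Pascal rule for the t-binomial. The nested fixpoint allows either m or d to decrease. *)
Fixpoint mono_seqs (m : nat) : nat -> nat -> seq (seq nat) :=
  fix aux d lo := match m with
  | 0 => [:: [::]]
  | m'.+1 => [seq lo :: u | u <- mono_seqs m' d lo] ++
             (if d is d'.+1 then aux d' lo.+1 else [::])
  end.

Lemma mono_seqsSS m d lo :
  mono_seqs m.+1 d.+1 lo =
  [seq lo :: u | u <- mono_seqs m d.+1 lo] ++ mono_seqs m.+1 d lo.+1.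
Proof. by []. Qed.

Lemma mem_mono_seqs m d lo u :
  (u \in mono_seqs m d lo) =
  [&& size u == m, path leq lo u & all (leq^~ (lo + d)%N) u].
Proof.
elim: m d lo u => [|m IHm] d lo u; first by case: d; case: u.
elim: d lo u => [|d IHd] lo [|x u]; rewrite /= mem_cat.
- by rewrite orbF; apply/mapP => -[].
- rewrite orbF addn0 eqSS; apply/mapP/idP => [[v + [-> ->]]|].
    by rewrite IHm leqnn addn0 /= => /and3P[-> -> ->].
  case/and3P => su /andP[lox] + /andP[xlo] ulo.
  have -> : x = lo by apply/eqP; rewrite eqn_leq xlo.
  by move=> pu; exists u; rewrite // IHm su pu addn0.
- by rewrite IHd /= orbF; apply/mapP => -[].
- rewrite IHd /= eqSS addSnnS.
  have -> : (x :: u \in [seq lo :: v | v <- mono_seqs m d.+1 lo]) =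
    (x == lo) && (u \in mono_seqs m d.+1 lo).
    apply/mapP/andP => [[v vm [-> ->]]|[/eqP -> um]]; by [|exists u].
  rewrite IHm; case: (eqVneq x lo) => [->|x_lo] /=.
    by rewrite ltnn leqnn leq_addr /= andbF orbF.
  by rewrite ltn_neqAle [lo == x]eq_sym x_lo.
Qed.

Lemma mono_seqs_uniq m d lo : uniq (mono_seqs m d lo).
Proof.
elim: m d lo => [|m IHm] d lo; first by case: d.
elim: d lo => [|d IHd] lo.
  by rewrite /= cats0 map_inj_uniq // => ? ? [].
rewrite mono_seqsSS cat_uniq map_inj_uniq ?IHm ?IHd ?andTb ?andbT;
  last by move=> ? ? [].
apply/hasPn => u; rewrite mem_mono_seqs => /and3P[_ lou _].
by apply/mapP => -[v _ uv]; move: lou; rewrite uv /= ltnn.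
Qed.

(** Subtracting lo from every entry leaves a partition inside an m by d box, and the t-binomial
    enumerates these by size. *)
Lemma sum_mono_seqs m d lo :
  \sum_(u <- mono_seqs m d lo) 'X^(sumn u) = 'X^(m * lo) * tbin (m + d) d :> {poly rat}.
Proof.
elim: m d lo => [|m IHm] d lo.
  by case: d => [|d]; rewrite /= big_seq1 mul1r ?add0n tbinn.
have head_sum e : \sum_(u <- [seq lo :: v | v <- mono_seqs m e lo]) 'X^(sumn u) =
    'X^(m.+1 * lo) * tbin (m + e) e.
  rewrite big_map mulSn exprD -mulrA -IHm mulr_sumr.
  by apply: eq_bigr => u _; rewrite exprD.
elim: d lo head_sum => [|d IHd] lo head_sum; rewrite big_cat /= head_sum.
  by rewrite big_nil addr0 !tbin0.
rewrite IHd; last first.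
  move=> e; rewrite big_map mulSn exprD -mulrA -IHm mulr_sumr.
  by apply: eq_bigr => u _; rewrite exprD.
by rewrite tbin_pascal mulnS [(m.+1 + _)%N]addnC exprD -mulrA -mulrDr.
Qed.

Lemma size_mono_seqs m d lo : size (mono_seqs m d lo) = 'C(m + d, d).
Proof.
elim: m d lo => [|m IHm] d lo; first by case: d => [|d] /=; rewrite add0n binn.
elim: d lo => [|d IHd] lo; first by rewrite /= cats0 size_map IHm !bin0.
by rewrite mono_seqsSS size_cat size_map IHm IHd [(_.+1 + _.+1)%N]addSn binS addSnnS.
Qed.

(** The label recovers the block from any of its members, so distinct blocks are disjoint. *)
Lemma uniq_flatten_label (T U : eqType) (L : T -> seq U) (lab : U -> T)
    (s : seq T) :
  uniq s -> {in s, forall x, uniq (L x)} ->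
  {in s, forall x, {in L x, forall y, lab y = x}} -> uniq (flatten (map L s)).
Proof.
elim: s => //= x s IHs /andP[xs us] Lu labE; rewrite cat_uniq Lu ?mem_head //=.
rewrite IHs ?andbT // => [||y ys]; last by apply: labE; rewrite inE ys orbT.
  apply/hasPn => z /flatten_mapP[y ys zLy]; apply: contra xs => zLx.
  by rewrite -(labE x _ z zLx) ?mem_head // (labE y _ z zLy) // inE ys orbT.
by move=> y ys; apply: Lu; rewrite inE ys orbT.
Qed.

(** The parameter y is M - s_M, the ordinate at which an up step of the associated Dyck path
    starts. *)
Fixpoint col_seqs (N : nat) : seq (seq nat) :=
  if N is M.+1 then
    [seq rcons s (M - y)%N | s <- col_seqs M, y <- iota 0 (M - last 0%N s).+1]
  else [:: [::]].

Definition is_col_seq (s : seq nat) : bool :=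
  path leq 0%N s && all (fun j => nth 0%N s j <= j)%N (iota 0 (size s)).

Lemma is_col_seq_rcons s x :
  is_col_seq (rcons s x) = is_col_seq s && (last 0 s <= x <= size s)%N.
Proof.
rewrite /is_col_seq rcons_path size_rcons -addn1 iotaD all_cat /= nth_rcons ltnn.
rewrite eqxx andbT add0n.
rewrite [X in X && (x <= _)%N](@eq_in_all _ _ (fun j => nth 0%N s j <= j)%N).
  by case: path; case: all; rewrite ?andbF //= andbT.
by move=> j; rewrite mem_iota add0n nth_rcons => /andP[_ ->].
Qed.

Lemma col_seq_last s : is_col_seq s -> (last 0 s <= (size s).-1)%N.
Proof.
case/lastP: s => // s x; rewrite is_col_seq_rcons last_rcons size_rcons.
by case/and3P.
Qed.

Lemma mem_col_seqs N (s : seq nat) : (s \in col_seqs N) = (size s == N) && is_col_seq s.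
Proof.
elim: N s => [|N IHN] s; first by case: s.
apply/allpairsPdep/idP => [[t [y []]]|].
  rewrite IHN mem_iota => /andP[/eqP st vt] /andP[_ yle] ->.
  rewrite size_rcons st eqxx is_col_seq_rcons vt /=; have := col_seq_last vt;
    simpl in *; lia.
case/lastP: s => // s x; rewrite size_rcons eqSS is_col_seq_rcons.
case/and4P => /eqP sN vs lx xs; exists s, (N - x)%N.
by rewrite IHN mem_iota sN vs eqxx; split=> //; simpl in *; [lia | congr rcons; lia].
Qed.

Lemma col_seqs_uniq N : uniq (col_seqs N).
Proof.
have u1 M s m : (m <= M.+1)%N -> uniq [seq rcons s (M - y)%N | y <- iota 0 m].
  move=> mM; rewrite map_inj_in_uniq ?iota_uniq // => x y.
  by rewrite !mem_iota /= => xm ym /rcons_inj[]; lia.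
elim: N => // N IHN; apply: (@uniq_flatten_label _ _ _ (take N)) => //.
  by move=> s _; apply: u1; rewrite ltnS leq_subr.
move=> s; rewrite mem_col_seqs => /andP[/eqP sN vs] _ /mapP[y _ ->].
by rewrite -cats1 -sN take_size_cat.
Qed.

Lemma col_seq_nth s j : is_col_seq s -> (nth 0 s j <= j)%N.
Proof.
case/andP => _ /allP vs; case: (ltnP j (size s)) => [js|sj].
  by apply: vs; rewrite mem_iota.
by rewrite nth_default.
Qed.

Lemma path_leq_all a r u : path leq a u ->
  (last a u <= r)%N = (a <= r)%N && all (leq^~ r) u.
Proof.
elim: u a => [|x u IHu] a /=; first by rewrite andbT.
case/andP => ax /IHu ->; case: (leqP x r) => xr; rewrite ?andbF //=.
by rewrite (leq_trans ax).
Qed.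

Lemma is_col_seq_nseq N : is_col_seq (nseq N 0%N).
Proof.
elim: N => // N IHN; rewrite -addn1 nseqD cats1 is_col_seq_rcons IHN /= andbT.
by rewrite leqn0; elim: (N).
Qed.

Lemma col_seq_last0 s : is_col_seq s -> last 0%N s = 0%N -> s = nseq (size s) 0%N.
Proof.
case/andP => /(path_leq_all 0) + _ s0; rewrite s0 leqnn /= => /esym s0'.
apply/all_pred1P; apply: sub_all s0' => x /=; by rewrite leqn0.
Qed.

(** A sequence with last entry r > 0 is cut at column r. The first r columns form an arbitrary
    sequence of their own; the later entries only have to be nondecreasing and at most r, because
    s_j <= j is automatic for j >= r. *)
Definition col_extensions (N r : nat) : seq (seq nat) :=
  [seq rcons (s ++ u) r |
     s <- col_seqs r, u <- mono_seqs (N - r) (r - last 0%N s) (last 0%N s)].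

Lemma mem_col_extensions N r s : (0 < r <= N)%N ->
  (s \in col_extensions N r) = (s \in col_seqs N.+1) && (last 0%N s == r).
Proof.
case/andP=> r_gt0 rN; rewrite mem_col_seqs; apply/allpairsPdep/idP => [[s' [u []]]|].
  rewrite mem_col_seqs mem_mono_seqs => /andP[/eqP s'r vs'] /and3P[/eqP su pu au] ->.
  have ls' := col_seq_last vs'.
  rewrite last_rcons eqxx andbT size_rcons size_cat s'r su subnKC // eqxx /=.
  rewrite is_col_seq_rcons size_cat last_cat s'r su subnKC // rN andbT path_leq_all //.
  rewrite subnKC in au; last by lia.
  rewrite au andbT (_ : last 0%N s' <= r)%N ?andbT; last by lia.
  rewrite /is_col_seq cat_path pu (andP vs').1; apply/allP => j.
  rewrite mem_iota size_cat s'r su nth_cat s'r => jN.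
  case: ltnP => jr; first exact: col_seq_nth.
  have [/(mem_nth 0%N)/(allP au) /=|/(nth_default 0%N) ->] := ltnP (j - r) (size u);
    lia.
case/lastP: s => // t x; rewrite last_rcons size_rcons eqSS => /andP[+ /eqP xr].
rewrite {x}xr is_col_seq_rcons => /and4P[/eqP tN vt lt _].
have tt' := cat_take_drop r t.
exists (take r t), (drop r t); rewrite tt'; split=> //.
  rewrite mem_col_seqs size_takel ?tN ?rN // eqxx.
  case/andP: vt => + /allP vt; rewrite -{1}tt' cat_path => /andP[p1 _].
  rewrite /is_col_seq p1; apply/allP => j; rewrite mem_iota size_takel ?tN //= => jr.
  by rewrite nth_take //; apply: vt; rewrite mem_iota; lia.
case/andP: vt => + _; rewrite -{1}tt' cat_path => /andP[p1 p2].
move: lt; rewrite -{1}tt' last_cat path_leq_all // => /andP[l1 l2].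
by rewrite mem_mono_seqs size_drop tN eqxx p2 subnKC.
Qed.

Lemma col_extensions_uniq N r : uniq (col_extensions N r).
Proof.
apply: (@uniq_flatten_label _ _ _ (take r)); first exact: col_seqs_uniq.
  by move=> s _; rewrite map_inj_uniq ?mono_seqs_uniq // => x y /rcons_inj[] /eqP;
    rewrite eqseq_cat // => /andP[_ /eqP].
move=> s; rewrite mem_col_seqs => /andP[/eqP sN _] _ /mapP[u _ ->].
by rewrite -cats1 -catA -sN take_size_cat.
Qed.

Lemma col_seqs_perm N :
  perm_eq (col_seqs N.+1)
    (nseq N.+1 0%N :: flatten [seq col_extensions N r | r <- iota 1 N]).
Proof.
apply: uniq_perm; first exact: col_seqs_uniq.
  rewrite cons_uniq (@uniq_flatten_label _ _ _ (last 0%N)) ?iota_uniq ?andbT //.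
  - apply/negP => /flatten_mapP[r]; rewrite mem_iota => rN.
    rewrite mem_col_extensions // => /andP[_];
      rewrite -[N.+1]addn1 nseqD cats1 last_rcons; lia.
  - by move=> r _; exact: col_extensions_uniq.
  - by move=> r; rewrite mem_iota => rN s;
    rewrite mem_col_extensions // => /andP[_ /eqP].
move=> s; rewrite inE; apply/idP/orP => [sN|[/eqP ->|]].
- case: (posnP (last 0%N s)) => [s0|s_gt0]; [left|right].
    by move: sN; rewrite mem_col_seqs => /andP[/eqP <- /col_seq_last0 <-].
  have rN : (0 < last 0%N s <= N)%N.
    by move: sN; rewrite mem_col_seqs => /andP[/eqP sN /col_seq_last]; lia.
  apply/flatten_mapP; exists (last 0%N s); first by rewrite mem_iota; lia.
  by rewrite mem_col_extensions // sN eqxx.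
- by rewrite mem_col_seqs size_nseq eqxx is_col_seq_nseq.
- by case/flatten_mapP => r; rewrite mem_iota => rN;
  rewrite mem_col_extensions // => /andP[].
Qed.

Lemma big_col_seqs (V : nmodType) N (G : seq nat -> V) :
  \sum_(s <- col_seqs N.+1) G s = G (nseq N.+1 0%N) +
  \sum_(1 <= r < N.+1) \sum_(s <- col_seqs r)
    \sum_(u <- mono_seqs (N - r) (r - last 0%N s) (last 0%N s)) G (rcons (s ++ u) r).
Proof.
rewrite (perm_big _ (col_seqs_perm N)) big_cons big_flatten big_map /index_iota subn1.
by congr (_ + _); apply: eq_bigr => r _; rewrite big_allpairs_dep.
Qed.

(** The pairs i < s_j compose as relations by iterating [col_next]: the m-th power is
    i < col_next^m (j + 1). *)
Definition col_next (s : seq nat) (m : nat) : nat := nth 0%N s m.-1.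

Definition has_class (s : seq nat) (k : nat) : bool :=
  (iter k (col_next s) (size s) != 0%N) && (iter k.+1 (col_next s) (size s) == 0%N).

Lemma col_next_le s m : is_col_seq s -> (col_next s m <= m.-1)%N.
Proof. exact: col_seq_nth. Qed.

Lemma col_next0 s : is_col_seq s -> col_next s 0 = 0%N.
Proof. by move/(@col_next_le s 0); rewrite leqn0 => /eqP. Qed.

Lemma iter_col_next_le s k m : is_col_seq s -> (iter k (col_next s) m <= m - k)%N.
Proof.
move=> vs; elim: k => [|k IHk] /=; first by rewrite subn0.
by have := col_next_le (iter k (col_next s) m) vs; lia.
Qed.

Lemma has_class_lt s k : is_col_seq s -> has_class s k -> (k < size s)%N.
Proof.
by move=> vs /andP[] /=; have := iter_col_next_le k (size s) vs; lia.
Qed.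

Lemma col_next_take s r m : is_col_seq s -> (m <= r)%N ->
  col_next (take r s) m = col_next s m.
Proof.
move=> vs mr; rewrite /col_next; case: m mr => [|m] mr /=; last by rewrite nth_take.
case: r mr => [|r] _; last by rewrite nth_take.
by rewrite take0 nth_nil; exact/esym/col_next0.
Qed.

Lemma col_next_size s : col_next s (size s) = last 0%N s.
Proof. by rewrite /col_next nth_last. Qed.

Lemma has_class_nseq N k : has_class (nseq N.+1 0%N) k = (k == 0%N).
Proof.
rewrite /has_class; have g0 m : col_next (nseq N.+1 0%N) m =
  0%N by rewrite /col_next nth_nseq if_same.
by rewrite size_nseq; case: k => [|k]; rewrite !iterS !g0.
Qed.

(** The first step of [col_next] leads from the full size to r, which is the size of s; all later
    steps read entries of s only. Hence the class grows by exactly one. *)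
Lemma has_class_rcons s u r k : is_col_seq (rcons (s ++ u) r) -> size s = r ->
  (0 < r)%N ->
  has_class (rcons (s ++ u) r) k = if k is k'.+1 then has_class s k' else false.
Proof.
set t := rcons _ _ => vt sr r_gt0; rewrite /has_class.
case: k => [|k]; first by rewrite /= col_next_size last_rcons (gtn_eqF r_gt0) andbF.
rewrite [iter k.+2 _ _]iterSr [iter k.+1 _ (size t)]iterSr col_next_size last_rcons.
have vs : is_col_seq s.
  have := vt; rewrite is_col_seq_rcons => /andP[+ _]; rewrite /is_col_seq cat_path.
  case/andP => /andP[-> _] /allP va; apply/allP => j; rewrite mem_iota => js.
  have := va j; rewrite nth_cat (andP js).2 mem_iota size_cat; apply; lia.
have st : s = take r t by rewrite /t -cats1 -catA -sr take_size_cat.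
suff it l : iter l (col_next t) r = iter l (col_next s) r by rewrite !it sr.
elim: l => //= l ->; rewrite st col_next_take // -st.
by rewrite (leq_trans (iter_col_next_le _ _ vs)) ?leq_subr.
Qed.

Lemma has_class_extension N r s u k : (0 < r <= N)%N -> s \in col_seqs r ->
  u \in mono_seqs (N - r) (r - last 0%N s) (last 0%N s) ->
  has_class (rcons (s ++ u) r) k = if k is k'.+1 then has_class s k' else false.
Proof.
move=> rN sr us; apply: has_class_rcons; last by case/andP: rN.
  have : rcons (s ++ u) r \in col_extensions N r by apply/allpairsPdep; exists s, u.
  by rewrite mem_col_extensions // => /andP[]; rewrite mem_col_seqs => /andP[].
by move: sr; rewrite mem_col_seqs => /andP[/eqP].
Qed.

(** * Chains *)

Fixpoint chain_seqs (k N : nat) : seq (seq nat) :=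
  if k is k'.+1 then [seq rcons c N | r <- iota 1 N.-1, c <- chain_seqs k' r]
  else if (0 < N)%N then [:: [:: 0%N; N]] else [::].

Definition is_chain_seq (k N : nat) (c : seq nat) : bool :=
  [&& size c == k.+2, nth 0%N c 0 == 0%N, last 0%N c == N & sorted ltn c].

Lemma mem_chain_seqs k N (c : seq nat) : (c \in chain_seqs k N) = is_chain_seq k N c.
Proof.
rewrite /is_chain_seq; elim: k N c => [|k IHk] N c.
  case: c => [|a [|b [|? ?]]]; case: N => [|N] //=; rewrite ?inE //.
  - by rewrite eqseq_cons andbF.
  - by case: a => [|a] //=; case: b.
  - by rewrite !eqseq_cons andbT; case: eqP => //= ->; case: eqP => //= ->.
  by rewrite !eqseq_cons !andbF.
apply/allpairsPdep/idP => [[r [c' []]]|].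
  rewrite mem_iota IHk => rN /and4P[/eqP sc /eqP c0 /eqP lc oc] ->.
  rewrite size_rcons sc last_rcons nth_rcons sc c0 !eqxx /=.
  case: c' sc c0 lc oc => // a c' _ _ lc oc; rewrite rcons_cons /= rcons_path.
  by simpl in *; rewrite oc lc /=; lia.
case/lastP: c => // c x; rewrite size_rcons eqSS last_rcons nth_rcons.
case/and4P=> /eqP sc; rewrite sc /= => c0 /eqP -> {x}.
case: c sc c0 => // a c sc c0; rewrite rcons_cons /= rcons_path => /andP[oc lN].
exists (last a c), (a :: c); rewrite IHk; split=> //; last by rewrite sc c0 /= oc !eqxx.
rewrite mem_iota; case: c sc oc lN {c0} =>
  // b c sc /= /andP[ab] /(order_path_min ltn_trans).
move=> /allP ac; have := mem_last b c; rewrite inE => /orP[/eqP ->|/ac /=]; lia.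
Qed.

Lemma chain_seqs_uniq k N : uniq (chain_seqs k N).
Proof.
elim: k N => [|k IHk] N /=; first by case: ifP.
apply: (@uniq_flatten_label _ _ _ (fun c => nth 0%N c k.+1)); first exact: iota_uniq.
  by move=> r _; rewrite map_inj_uniq // => ? ? /rcons_inj[].
move=> r _ _ /mapP[c + ->]; rewrite mem_chain_seqs => /and4P[/eqP sc _ /eqP <- _].
by rewrite nth_rcons sc leqnn -nth_last sc.
Qed.

Definition chain_seq_weight (k : nat) (c : seq nat) : {poly rat} :=
  let i := nth 0%N (rcons c (last 0%N c).+1) in
  \prod_(j < k) ('X^(i j.+1 * (i j.+3 - i j.+2)) *
                 tbin (i j.+2 - i j - 1) (i j.+1 - i j)).

(** Appending N changes the old weight in one place: the entry after r was r + 1 and becomes N, so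
    the exponent of the last old factor grows by (N - r - 1) i_k. The new factor has exponent r * 1,
    since its two top entries are N and N + 1. *)
Lemma chain_seq_weight_rcons k r N c : is_chain_seq k r c -> (r < N)%N ->
  chain_seq_weight k.+1 (rcons c N) =
  chain_seq_weight k c * ('X^(r + (N - r.+1) * nth 0%N c k) *
             tbin (N - nth 0%N c k - 1) (r - nth 0%N c k)).
Proof.
case/and4P=> /eqP sc /eqP c0 /eqP lc _ rN;
  rewrite /chain_seq_weight last_rcons lc !big_split /=.
have old M j : (j <= k.+1)%N -> nth 0%N (rcons c M) j = nth 0%N c j.
  by move=> jk; rewrite nth_rcons sc ltnS jk.
have old2 j : (j <= k.+1)%N -> nth 0%N (rcons (rcons c N) N.+1) j = nth 0%N c j.
  by move=> jk; rewrite nth_rcons size_rcons sc ltnS (leqW jk) old.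
have rE : nth 0%N c k.+1 = r by rewrite -lc -nth_last sc.
have i2 : nth 0%N (rcons (rcons c N) N.+1) k.+2 = N.
  by rewrite nth_rcons size_rcons sc ltnSn nth_rcons sc ltnn eqxx.
have i3 : nth 0%N (rcons (rcons c N) N.+1) k.+3 = N.+1.
  by rewrite nth_rcons size_rcons sc ltnn eqxx.
have i1 : nth 0%N (rcons c r.+1) k.+2 = r.+1.
  by rewrite nth_rcons sc ltnn eqxx.
rewrite mulrACA; congr (_ * _); last first.
  rewrite big_ord_recr /= i2 !old2 ?leqnSn // rE; congr (_ * _).
  by apply: eq_bigr => j _; have jk := ltn_ord j; rewrite !old2 ?old //; lia.
rewrite -!expr_sum -exprD; congr ('X^_).
rewrite big_ord_recr /= i2 i3 old2 // rE subSnn muln1.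
(* For k = 0 there is no old factor to correct, and the correction vanishes because i_0 = 0. *)
case: k => [|k] in sc old old2 rE i1 i2 i3 *; first by rewrite !big_ord0 c0; lia.
rewrite !big_ord_recr /= i1 i2 !old2 // !old // rE.
rewrite (eq_bigr (fun j : 'I_k => nth 0 c j.+1 * (nth 0 c j.+3 - nth 0 c j.+2)))%N;
  last first.
  by move=> j _; have jk := ltn_ord j; rewrite !old2 //; lia.
rewrite [X in _ = (X + _ + _)%N](eq_bigr (fun j : 'I_k =>
  nth 0 c j.+1 * (nth 0 c j.+3 - nth 0 c j.+2)))%N; last first.
  by move=> j _; have jk := ltn_ord j; rewrite !old //; lia.
by move: (\sum_(i < k) _)%N => S; nia.
Qed.

(** The weight of the last block depends on the last two chain entries only, so
    the induction carries a function phi of the last entry but one. *)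
Lemma sum_col_seqs_chain_seqs k N (phi : nat -> {poly rat}) : (0 < N)%N ->
  \sum_(s <- col_seqs N | has_class s k) 'X^(sumn s) * phi (last 0%N s) =
  \sum_(c <- chain_seqs k N) chain_seq_weight k c * phi (nth 0%N c k).
Proof.
elim: k N phi => [|k IHk] [//|N] phi _;
  rewrite big_mkcond big_col_seqs has_class_nseq /=.
  rewrite big_seq1 /chain_seq_weight big_ord0 mul1r /= [X in _ + X]big1_seq ?addr0.
    have -> : last 0%N (nseq N 0%N) = 0%N by elim: (N).
    by have -> : sumn (nseq N 0%N) = 0%N; [elim: (N)|rewrite mul1r].
  move=> r /=; rewrite mem_index_iota => rN; rewrite big1_seq // => s /= sr.
  by rewrite big1_seq // => u /= us; rewrite (@has_class_extension N).
rewrite add0r big_allpairs_dep /index_iota subn1.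
apply: eq_big_seq => r; rewrite mem_iota => rN.
(* Summed over u, the block and the entry r contribute a factor that depends on s only through its
   last entry, so this factor can serve as [phi] in the induction hypothesis. *)
transitivity (\sum_(s <- col_seqs r | has_class s k) 'X^(sumn s) *
   (phi r * ('X^(r + (N.+1 - r.+1) * last 0%N s) *
       tbin (N.+1 - last 0%N s - 1) (r - last 0%N s)))).
  rewrite [RHS]big_mkcond; apply: eq_big_seq => s sr.
  transitivity (\sum_(u <- mono_seqs (N - r) (r - last 0%N s) (last 0%N s))
      if has_class s k then 'X^(sumn u) * ('X^(sumn s) * 'X^r * phi r) else 0).
    apply: eq_big_seq => u us; rewrite (@has_class_extension N) //.
    case: ifP => // _; rewrite last_rcons -cats1 !sumn_cat /= addn0 !exprD.
    by rewrite !mulrA (mulrC 'X^(sumn s)).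
  case: ifP => _; last by rewrite big1.
  rewrite -mulr_suml sum_mono_seqs subSS exprD.
  have -> : (N - r + (r - last 0 s) = N.+1 - last 0 s - 1)%N.
    move: sr; rewrite mem_col_seqs => /andP[/eqP sr /col_seq_last]; simpl in *; lia.
  by move: ('X^(_ * _)) ('X^(sumn s)) ('X^r) => A B D; ring.
rewrite (IHk r (fun p => phi r * ('X^(r + (N.+1 - r.+1) * p) *
       tbin (N.+1 - p - 1) (r - p)))) //; last by simpl in *; lia.
apply: eq_big_seq => c; rewrite mem_chain_seqs => cr.
rewrite (chain_seq_weight_rcons cr) //; last by simpl in *; lia.
case/and4P: (cr) => /eqP sc _ _ _.
rewrite nth_rcons sc ltnSn -/(nth _ _ _) (_ : nth 0%N c k.+1 = r).
  by rewrite -mulrA [phi r * _]mulrC.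
by case/and4P: cr => _ _ /eqP <- _; rewrite -nth_last sc.
Qed.

Lemma sum_chain_weight n k :
  \sum_(s : k.+2.-tuple 'I_n.+2 | is_chain s) chain_weight s =
  \sum_(c <- chain_seqs k n.+1) chain_seq_weight k c.
Proof.
have -> : \sum_(c <- chain_seqs k n.+1) chain_seq_weight k c = \sum_(c <-
    [seq map val (tval s) | s <- enum (@is_chain n k)]) chain_seq_weight k c.
  apply: perm_big; apply: uniq_perm; first exact: chain_seqs_uniq.
    rewrite map_inj_uniq ?enum_uniq // => s t /(inj_map val_inj) st; exact: val_inj.
  move=> c; rewrite mem_chain_seqs; apply/and4P/mapP => [[/eqP sc c0 lc oc]|[s]].
    have cn : all (fun i => i < n.+2)%N c.
      apply/(all_nthP 0%N) => i; rewrite sc => ik.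
      rewrite -(eqP lc) -nth_last sc /= -[X in (_ < X)%N]addn1 -ltnS addn1 !ltnS.
      have [//|ik'] := eqVneq i k.+1; first by move=> ->.
      apply: ltnW; apply: (sorted_ltn_nth ltn_trans) => //; rewrite ?inE ?sc //; lia.
    have st : size (map (@inord n.+1) c) == k.+2 by rewrite size_map sc.
    have vE : map val (map (@inord n.+1) c) = c.
      by rewrite -map_comp -[RHS]map_id; apply/eq_in_map => i /(allP cn) /inordK.
    exists (Tuple st); last by rewrite vE.
    rewrite mem_enum unfold_in /is_chain /= !vE lc oc !andbT.
    rewrite /thead (tnth_nth ord0) /= (nth_map 0%N) ?sc //.
    by rewrite inordK ?(eqP c0).
  rewrite mem_enum unfold_in /is_chain => /and3P[s0 ls os] ->.
  rewrite size_map size_tuple eqxx ls os; split=> //; move: s0 {ls os}.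
  by case/tupleP: s => x t; rewrite theadE.
rewrite big_map big_enum; apply: eq_bigr => s /and3P[_ /eqP ls _].
by rewrite /chain_weight /chain_seq_weight /chain_entry ls.
Qed.

(** * Height sequences of Dyck paths *)

Definition heights (s : seq nat) : seq nat :=
  [seq (j - nth 0 s j)%N | j <- iota 0 (size s)].

Lemma size_heights s : size (heights s) = size s.
Proof. by rewrite size_map size_iota. Qed.

Lemma heights_rcons s x : heights (rcons s x) = rcons (heights s) (size s - x)%N.
Proof.
rewrite /heights size_rcons -addn1 iotaD map_cat cats1 add0n nth_rcons ltnn eqxx.
congr rcons; apply/eq_in_map => j; rewrite mem_iota => /andP[_ js].
by rewrite nth_rcons js.
Qed.

Definition height_step : rel nat := fun a b => (b <= a.+1)%N.

(** Shifting by 1 and starting at 0 also forces the first entry to be 0. *)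
Definition is_height_seq (c : seq nat) : bool := path height_step 0%N (map S c).

Lemma heights_is_height_seq s : is_col_seq s ->
  is_height_seq (heights s) /\ last 0%N (map S (heights s)) = (size s - last 0 s)%N.
Proof.
elim/last_ind: s => // s x IHs; rewrite is_col_seq_rcons => /andP[/IHs[vs ls] xs].
rewrite /is_height_seq in vs *;
  rewrite heights_rcons map_rcons rcons_path vs !last_rcons size_rcons ls /height_step.
by split; lia.
Qed.

Lemma height_seqP c : is_height_seq c -> exists2 s, is_col_seq s & c = heights s.
Proof.
elim/last_ind: c => [|c y IHc]; first by exists [::].
rewrite /is_height_seq map_rcons rcons_path => /andP[/IHc[s vs cE]].
case: (heights_is_height_seq vs) => _; rewrite cE /height_step => -> yle.
exists (rcons s (size s - y)%N).
  by rewrite is_col_seq_rcons vs; have := col_seq_last vs; simpl in *; lia.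
rewrite heights_rcons; congr rcons; simpl in *; lia.
Qed.

Definition height_seqs (N : nat) : seq (seq nat) := map heights (col_seqs N).

Lemma mem_height_seqs N (c : seq nat) : (c \in height_seqs N) =
  (size c == N) && is_height_seq c.
Proof.
apply/mapP/andP => [[s + ->]|[/eqP sc /height_seqP [s vs cE]]].
  by rewrite mem_col_seqs size_heights => /andP[-> /heights_is_height_seq[]].
by exists s; rewrite // mem_col_seqs vs andbT -sc cE size_heights.
Qed.

Lemma height_seqs_uniq N : uniq (height_seqs N).
Proof.
rewrite map_inj_in_uniq ?col_seqs_uniq // => s t.
rewrite !mem_col_seqs => /andP[/eqP ss vs] /andP[/eqP st vt] st_eq.
apply: (@eq_from_nth _ 0%N) => [|j]; rewrite ss // => jN.
have := congr1 (fun c => nth 0%N c j) st_eq.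
rewrite !(nth_map 0%N) ?size_iota ?ss ?st // nth_iota //.
by rewrite !add0n; have := col_seq_nth j vs; have := col_seq_nth j vt; simpl in *; lia.
Qed.

Lemma is_height_seq_cons x u : is_height_seq (x :: u) =
  (x == 0%N) && path height_step 0%N u.
Proof.
rewrite /is_height_seq /= /height_step ltnS leqn0; case: eqP => //= ->.
by elim: u 0%N => //= y u IHu x'; rewrite IHu.
Qed.

(** All ways to insert m zeros into c + 1 so that no step rises by more than 1:
    a zero fits before an entry 1 and at the end only. *)
Fixpoint insert0s (c : seq nat) : nat -> seq (seq nat) :=
  fix aux m := match c with
  | [::] => [:: nseq m 0%N]
  | 0 :: c' => [seq 1%N :: u | u <- insert0s c' m] ++
      (if m is m'.+1 then [seq 0%N :: u | u <- aux m'] else [::])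
  | x.+1 :: c' => [seq x.+2 :: u | u <- insert0s c' m]
  end.

Lemma insert0s_0S c m : insert0s (0%N :: c) m.+1 =
  [seq 1%N :: u | u <- insert0s c m.+1] ++ [seq 0%N :: u | u <- insert0s (0%N :: c) m].
Proof. by []. Qed.

Lemma insert0s_00 c : insert0s (0%N :: c) 0 = [seq 1%N :: u | u <- insert0s c 0].
Proof. by rewrite /= cats0. Qed.

Lemma insert0s_S x c m : insert0s (x.+1 :: c) m = [seq x.+2 :: u | u <- insert0s c m].
Proof. by case: m. Qed.

Lemma insert0s_nil m : insert0s [::] m = [:: nseq m 0%N].
Proof. by case: m. Qed.

(** On paths, the up steps leaving the axis are removed and everything above comes down by one; this
    is the inverse of inserting zeros into c + 1. *)
Definition drop_ground (u : seq nat) : seq nat := [seq x.-1 | x <- u & (0 < x)%N].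

Lemma mem_insert0s b c m (u : seq nat) : path height_step b (map S c) ->
  u \in insert0s c m ->
  [/\ path height_step b u, drop_ground u = c & count_mem 0%N u = m].
Proof.
elim: c b m u => [|[|x] c IHc] b m u.
- rewrite insert0s_nil inE => _ /eqP ->; split; try by elim: m.
    by elim: m b => //= m IHm b; rewrite IHm.
  by rewrite count_nseq /= mul1n.
- move=> pc0; have {pc0}pc : path height_step 1 (map S c) by [].
  elim: m b u => [|m IHm] b u.
    by rewrite insert0s_00 => /mapP[v /IHc-/(_ 1%N pc)[vp vc vm] ->];
      rewrite /drop_ground /= -/(drop_ground v) vc vm.
  rewrite insert0s_0S mem_cat => /orP[] /mapP[v].
    by move=> /IHc-/(_ 1%N pc)[vp vc vm] ->;
      rewrite /drop_ground /= -/(drop_ground v) vc vm.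
  by move=> /(IHm 0%N)[vp vc vm] ->; rewrite /drop_ground /= -/(drop_ground v) vc vm vp.
- rewrite insert0s_S /= => /andP[xb pc] /mapP[v /IHc-/(_ _ pc)[vp vc vm] ->].
  by rewrite /drop_ground /= -/(drop_ground v) vc vm vp xb.
Qed.

Lemma insert0s_complete b (u : seq nat) : path height_step b u ->
  path height_step b (map S (drop_ground u)) /\
  u \in insert0s (drop_ground u) (count_mem 0%N u).
Proof.
elim: u b => [|x u IHu] b //= /andP[xb /IHu[pu uu]].
have pos0 : drop_ground (0%N :: u) = drop_ground u by [].
have posS y : drop_ground (y.+1 :: u) = y :: drop_ground u by [].
case: x => [|[|x]] in xb pu *; rewrite ?pos0 ?posS.
(* After a 0 the first positive entry of u can only be 1, so [drop_ground u] is empty or starts with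
   0; the third case contradicts [pu]. *)
- rewrite [(_ + _)%N]add1n; case uE: (drop_ground u) => [|[|x] c] in pu uu *.
  + by rewrite !insert0s_nil !inE in uu *; rewrite /= -(eqP uu).
  + by split; [rewrite /= in pu * | rewrite insert0s_0S mem_cat map_f ?orbT].
  + by rewrite /= in pu.
- split; first by rewrite /= pu.
  rewrite [(_ + _)%N]add0n.
  by case: (count _ u) uu => [|m] uu; rewrite ?insert0s_00 ?insert0s_0S ?mem_cat map_f.
- by rewrite insert0s_S /= xb pu map_f.
Qed.

Lemma insert0s_uniq c m : uniq (insert0s c m).
Proof.
elim: c m => [|[|x] c IHc] m; first by rewrite insert0s_nil.
  elim: m => [|m IHm]; first by rewrite insert0s_00 map_inj_uniq // => ? ? [].
  rewrite insert0s_0S cat_uniq !map_inj_uniq ?IHc ?IHm ?andbT ?andTb;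
    try by move=> ? ? [].
  by apply/hasPn => u /mapP[v _ ->]; apply/mapP => -[].
by rewrite insert0s_S map_inj_uniq // => ? ? [].
Qed.

(** The m zeros are distributed over one slot in front of each 0 of c and one slot at the end. *)
Lemma size_insert0s c m : size (insert0s c m) =
  'C(m + count_mem 0%N c, count_mem 0%N c).
Proof.
elim: c m => [|[|x] c IHc] m; first by rewrite insert0s_nil bin0.
  elim: m => [|m IHm]; first by rewrite insert0s_00 size_map IHc !add0n !binn.
  rewrite insert0s_0S size_cat !size_map IHm IHc /= add1n [(m.+1 + _.+1)%N]addSn binS
    addnC.
  by rewrite addSnnS.
by rewrite insert0s_S size_map IHc.
Qed.

Lemma count_drop_ground u : (count_mem 0%N u + size (drop_ground u) = size u)%N.
Proof. by elim: u => //= -[|x] u; rewrite /drop_ground /=; lia. Qed.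

(** The first entry of a height sequence is always 0, so among the N + 1 - r zeros only N - r can be
    placed freely. *)
Definition ground_insertions (N r : nat) : seq (seq nat) :=
  [seq 0%N :: u | c <- height_seqs r, u <- insert0s c (N - r)].

Lemma mem_ground_insertions N r (c : seq nat) : (0 < r <= N)%N ->
  (c \in ground_insertions N r) =
    (c \in height_seqs N.+1) && (size (drop_ground c) == r).
Proof.
case/andP=> r_gt0 rN; rewrite mem_height_seqs; apply/allpairsPdep/idP => [[c' [u []]]|].
  rewrite mem_height_seqs => /andP[/eqP sc vc] /(mem_insert0s vc)[pu uc um] ->.
  rewrite /= is_height_seq_cons pu eqxx /drop_ground /= -/(drop_ground u)
    -(count_drop_ground u) um uc sc.
  by rewrite subnK ?eqxx.
case: c => // x u; rewrite is_height_seq_cons => /andP[/and3P[su /eqP -> pu]].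
rewrite /drop_ground /= -/(drop_ground u) => /eqP ur;
  have [vu uu] := insert0s_complete pu.
exists (drop_ground u), u; rewrite mem_height_seqs ur eqxx; split => //.
by have := count_drop_ground u; rewrite ur (eqP (_ : size u == N)) // => <-;
  rewrite addnK.
Qed.

Lemma ground_insertions_uniq N r : uniq (ground_insertions N r).
Proof.
apply: (@uniq_flatten_label _ _ _ drop_ground); first exact: height_seqs_uniq.
  by move=> s _; rewrite map_inj_uniq ?insert0s_uniq // => x y [].
move=> c; rewrite mem_height_seqs =>
  /andP[_ vc] _ /mapP[u /(mem_insert0s vc)[_ uc _] ->].
exact: uc.
Qed.

Lemma is_height_seq_nseq N : is_height_seq (nseq N 0%N).
Proof.
case: N => // N; rewrite /= is_height_seq_cons eqxx /=.
by elim: N => //= N.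
Qed.

Lemma drop_ground_nil u : size (drop_ground u) = 0%N -> u = nseq (size u) 0%N.
Proof. by elim: u => //= -[|x] u IHu //; rewrite /drop_ground /= => /IHu {1}->. Qed.

Lemma height_seqs_perm N :
  perm_eq (height_seqs N.+1)
    (nseq N.+1 0%N :: flatten [seq ground_insertions N r | r <- iota 1 N]).
Proof.
have pos0 M : size (drop_ground (nseq M 0%N)) = 0%N by elim: M.
apply: uniq_perm; first exact: height_seqs_uniq.
  rewrite cons_uniq (@uniq_flatten_label _ _ _ (size \o drop_ground)) ?iota_uniq ?andbT
    //.
  - apply/negP => /flatten_mapP[r]; rewrite mem_iota => rN.
    by rewrite mem_ground_insertions // => /andP[_]; rewrite pos0; simpl in *; lia.
  - by move=> r _; exact: ground_insertions_uniq.
  - by move=> r; rewrite mem_iota => rN s;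
    rewrite mem_ground_insertions // => /andP[_ /eqP].
move=> c; rewrite inE; apply/idP/orP => [cN|[/eqP ->|]].
- case: (posnP (size (drop_ground c))) => [s0|s_gt0]; [left|right].
    by move: cN; rewrite mem_height_seqs => /andP[/eqP <- _];
      rewrite {1}(drop_ground_nil s0).
  have rN : (0 < size (drop_ground c) <= N)%N.
    rewrite s_gt0; move: cN; rewrite mem_height_seqs; case: (c) => // x u.
    rewrite is_height_seq_cons => /andP[/eqP su /andP[/eqP -> _]].
    by have := count_drop_ground u; rewrite /drop_ground /= in su *; lia.
  apply/flatten_mapP; exists (size (drop_ground c)); first by rewrite mem_iota; lia.
  by rewrite mem_ground_insertions // cN eqxx.
- by rewrite mem_height_seqs size_nseq eqxx is_height_seq_nseq.
- by case/flatten_mapP => r; rewrite mem_iota => rN;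
  rewrite mem_ground_insertions // => /andP[].
Qed.

Lemma big_height_seqs (V : nmodType) N (G : seq nat -> V) :
  \sum_(c <- height_seqs N.+1) G c = G (nseq N.+1 0%N) +
  \sum_(1 <= r < N.+1) \sum_(c <- height_seqs r)
    \sum_(u <- insert0s c (N - r)) G (0%N :: u).
Proof.
rewrite (perm_big _ (height_seqs_perm N)) big_cons big_flatten big_map /index_iota
  subn1.
by congr (_ + _); apply: eq_bigr => r _; rewrite big_allpairs_dep.
Qed.

Definition max_seq (c : seq nat) : nat := foldr maxn 0%N c.

Lemma max_seq_nseq N : max_seq (nseq N 0%N) = 0%N.
Proof. by elim: N => //= N; rewrite /max_seq /= => ->. Qed.

Lemma max_seq_drop_ground u : (0 < size (drop_ground u))%N ->
  max_seq u = (max_seq (drop_ground u)).+1.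
Proof.
have maxcE x v : max_seq (x :: v) = maxn x (max_seq v) by [].
have pos0 v : drop_ground (0%N :: v) = drop_ground v by [].
have posS y v : drop_ground (y.+1 :: v) = y :: drop_ground v by [].
elim: u => // -[|x] u IHu; rewrite ?pos0 ?posS !maxcE.
  by move/IHu => ->; rewrite max0n.
move=> _; case: (posnP (size (drop_ground u))) => [u0|/IHu ->]; last by rewrite maxnSS.
by rewrite (size0nil u0) (drop_ground_nil u0) max_seq_nseq !maxn0.
Qed.

(** Both sides obey the same recursion. An object of size r with second statistic p extends in C((N
    - r) + (r - p), r - p) ways to one of size N + 1 with second statistic r, and the class or the
    maximum grows by one. For a height sequence, r - p is its number of zeros, which determines the
    slots for insertion; for a column sequence it is the width of the range allowed for the
    block. *)
Lemma sum_height_seqs_col_seqs k N (phi : nat -> nat) : (0 < N)%N ->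
  (\sum_(c <- height_seqs N | max_seq c == k) phi (size (drop_ground c)) =
   \sum_(s <- col_seqs N | has_class s k) phi (last 0 s))%N.
Proof.
elim: k N phi => [|k IHk] [//|N] phi _;
  rewrite !(big_mkcond (fun s => _ == _)) !(big_mkcond (fun s => has_class s _)).
  rewrite [LHS](@big_height_seqs nat) [RHS](@big_col_seqs nat) has_class_nseq
    max_seq_nseq /=.
  have -> : last 0%N (nseq N 0%N) = 0%N by elim: (N).
  have -> : size (drop_ground (0%N :: nseq N 0%N)) = 0%N by elim: (N).
  congr (_ + _)%N; rewrite [LHS]big1_seq ?[RHS]big1_seq // => r /=;
    rewrite mem_index_iota => rN.
    rewrite big1_seq // => s /= sr.
    by rewrite big1_seq // => u /= us; rewrite (@has_class_extension N).
  rewrite big1_seq // => c; rewrite mem_height_seqs => /= /andP[/eqP sc vc].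
  rewrite big1_seq // => u /= /(mem_insert0s vc)[_ uc _].
  by rewrite max0n -/(max_seq u) max_seq_drop_ground uc ?sc //; case/andP: rN.
rewrite [LHS](@big_height_seqs nat) [RHS](@big_col_seqs nat) has_class_nseq
  max_seq_nseq /=.
congr (_ + _)%N; apply: eq_big_seq => r; rewrite mem_index_iota => rN.
transitivity (\sum_(c <- height_seqs r | max_seq c == k)
   (phi r * 'C(N - r + (r - size (drop_ground c)), r - size (drop_ground c))))%N.
  rewrite [RHS]big_mkcond; apply: eq_big_seq => c;
    rewrite mem_height_seqs => /andP[/eqP sc vc].
  transitivity (\sum_(u <- insert0s c (N - r)) if max_seq c == k then phi r else 0%N)%N.
    apply: eq_big_seq => u /(mem_insert0s vc)[_ uc _];
      rewrite max0n -/(max_seq u) max_seq_drop_ground uc ?sc; last by case/andP: rN.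
    by rewrite eqSS /drop_ground /= -/(drop_ground u) uc sc.
  rewrite big_const_seq count_predT iter_addn_0 size_insert0s -sc -(count_drop_ground
    c) addnK.
  by case: ifP => //.
rewrite (IHk r (fun p => phi r * 'C(N - r + (r - p), r - p)))%N; last by case/andP: rN.
rewrite big_mkcond; apply: eq_big_seq => s sr.
transitivity (\sum_(u <- mono_seqs (N - r) (r - last 0%N s) (last 0%N s))
      if has_class s k then phi r else 0%N)%N.
  rewrite big_const_seq count_predT iter_addn_0 size_mono_seqs.
  by case: ifP.
by apply: eq_big_seq => u us; rewrite (@has_class_extension N) // last_rcons.
Qed.

(** * Dyck words *)

Fixpoint dyck_from (h : nat) (p : seq bool) : bool :=
  match p with
  | [::] => h == 0%N
  | true :: p => dyck_from h.+1 p
  | false :: p => (0 < h)%N && dyck_from h.-1 p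
  end.

Lemma ordinate0 p : ordinate p 0 = 0.
Proof. by rewrite /ordinate take0 big_nil. Qed.

Lemma ordinateS b p m : ordinate (b :: p) m.+1 = (if b then 1 else -1) + ordinate p m.
Proof. by rewrite /ordinate /= big_cons. Qed.

Lemma dyck_from_ordinate h p : dyck_from h p =
  all (fun m => 0 <= h%:Z + ordinate p m) (iota 0 (size p).+1) &&
  (h%:Z + ordinate p (size p) == 0).
Proof.
have aS q (f : nat -> bool) : all f (iota 0 (size q).+2) = f 0%N && all (fun m =>
  f m.+1) (iota 0 (size q).+1).
  by rewrite /= (iotaDl 1 1) all_map.
elim: p h => [|b p IHp] h; first by rewrite /= ordinate0 addr0 andbT; case: h.
rewrite [size _]/= aS ordinateS ordinate0 addr0 lez_nat leq0n andTb.
have SE k : k.+1%:Z = k%:Z + 1 by rewrite -addn1 PoszD.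
case: b => /=.
  rewrite IHp SE addrA; congr (_ && _).
  by apply: eq_all => m; rewrite ordinateS addrA.
case: h => [|h] /=; first by rewrite ?ordinateS ordinate0.
rewrite IHp SE addrA addrK; congr (_ && _).
by apply: eq_all => m; rewrite ordinateS addrA addrK.
Qed.

Lemma dyckE p : dyck p = dyck_from 0 p.
Proof.
rewrite dyck_from_ordinate /dyck add0r; congr (_ && _).
by apply: eq_all => m; rewrite add0r.
Qed.

Fixpoint up_heights (h : nat) (p : seq bool) : seq nat :=
  match p with
  | [::] => [::]
  | true :: p => h :: up_heights h.+1 p
  | false :: p => up_heights h.-1 p
  end.

Fixpoint height_word (h : nat) (c : seq nat) : seq bool :=
  if c is x :: c then nseq (h
    - x) false ++ true :: height_word x.+1 c else nseq h false.

(** Under [map S] an entry becomes the ordinate that its up step reaches, and the next up step can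
    start no higher than that. *)
Lemma up_heightsK h p : dyck_from h p ->
  path height_step h (map S (up_heights h p)) /\ height_word h (up_heights h p) = p.
Proof.
elim: p h => [|[] p IHp] h /=; first by move/eqP ->.
  by case/IHp => -> ->; rewrite /height_step ltnS leqnn subnn.
case: h => //= h /IHp[]; case: (up_heights h p) => [|x c] /=; first by move=> _ ->.
by case/andP => xh -> <-; rewrite /height_step in xh *; rewrite (leqW xh) subSn.
Qed.

Lemma height_wordK h c : path height_step h (map S c) ->
  [/\ dyck_from h (height_word h c), up_heights h (height_word h c) = c
    & size (height_word h c) = (h + (size c).*2)%N].
Proof.
have nf k m q : [/\ dyck_from (k + m) (nseq k false ++ q) =
  dyck_from m q & up_heights (k + m) (nseq k false ++ q) = up_heights m q].
  by elim: k => //= k [-> ->].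
elim: c h => [|x c IHc] h /=.
  have [] := nf h 0%N [::]; rewrite addn0 cats0 => -> -> _; split=> //;
    rewrite size_nseq; lia.
case/andP=> xh /IHc[dx hx sx]; rewrite /height_step ltnS in xh.
have [] := nf (h - x)%N x (true :: height_word x.+1 c); rewrite subnK // => -> ->.
rewrite /= dx hx size_cat size_nseq /= sx; split=> //; lia.
Qed.

Lemma sum_dyck (V : nmodType) n (G : seq bool -> V) :
  \sum_(p : (2 * n + 2).-tuple bool | dyck p) G p =
    \sum_(c <- height_seqs n.+1) G (height_word 0 c).
Proof.
pose D := [pred p : (2 * n + 2).-tuple bool | dyck p].
rewrite -(big_map (height_word 0) xpredT G).
have -> : \sum_(p : (2 * n + 2).-tuple bool | dyck p) G p =
    \sum_(q <- [seq tval p | p <- enum D]) G q by rewrite big_map big_enum.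
apply: perm_big.
have vP c : c \in height_seqs n.+1 -> path height_step 0 (map S c)
  by rewrite mem_height_seqs => /andP[].
apply: uniq_perm.
- by rewrite map_inj_uniq ?enum_uniq //; exact: val_inj.
- rewrite map_inj_in_uniq ?height_seqs_uniq // =>
  c d /vP/height_wordK[_ cE _] /vP/height_wordK[_ dE _] cd.
  by rewrite -cE cd dE.
move=> p; apply/mapP/mapP => [[q qD pq]|[c cN ->]].
  have dp : dyck_from 0 p by rewrite pq -dyckE; move: qD; rewrite mem_enum.
  have [pv pE] := up_heightsK dp.
  exists (up_heights 0 p) => //; rewrite mem_height_seqs /is_height_seq pv andbT.
  have [_ _] := height_wordK pv; rewrite pE pq size_tuple; simpl in *; lia.
have [cd _ sc] := height_wordK (vP _ cN).
have st : size (height_word 0 c) == (2 * n + 2)%N.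
  by rewrite sc; move: cN; rewrite mem_height_seqs => /andP[/eqP ->]; lia.
by exists (Tuple st); rewrite // mem_enum inE dyckE.
Qed.

(** [b] tells whether the step before [p] goes up. *)
Fixpoint height_from (h : nat) (b : bool) (p : seq bool) : nat :=
  match p with
  | [::] => 0%N
  | true :: p => height_from h.+1 true p
  | false :: p => maxn (if b then h else 0%N) (height_from h.-1 false p)
  end.

(** Prepending b makes entry m of the word the step just before abscissa m. With b = false, abscissa
    0 is not a peak, in agreement with [is_peak]. *)
Lemma height_from_bigmax h b p : dyck_from h p ->
  \max_(m < size p | nth false (b :: p) m && ~~ nth true p m)
    absz (h%:Z + ordinate p m)%R = height_from h b p.
Proof.
elim: p h b => [|s p IHp] h b; first by rewrite big_ord0.
rewrite big_mkcond big_ord_recl /= ordinate0 addr0.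
set S := (X in maxn _ X) => dp.
have -> : S = \max_(m < size p | nth false (s :: p) m && ~~ nth true p m)
    absz ((h%:Z + (if s then 1 else -1)) + ordinate p m)%R.
  rewrite [RHS]big_mkcond; apply: eq_bigr => m _ /=.
  by rewrite ordinateS addrA.
case: s dp {S} => /=.
  by move=> dp; rewrite andbF max0n -PoszD addn1 IHp.
by case: h => //= h dp; rewrite andbT -addn1 PoszD addrK IHp //; case: b.
Qed.

(** The maximum may be taken over the ends of all up steps: an end that is not a peak is followed by
    a higher one. *)
Lemma height_from_up_heights h b p : dyck_from h p ->
  height_from h b p = maxn (if b then h else 0) (max_seq (map S (up_heights h p))).
Proof.
have mS x c : max_seq (map S (x :: c)) = maxn x.+1 (max_seq (map S c)) by [].
elim: p h b => [|[] p IHp] h b; first by move=> /= /eqP ->; case: b.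
  move=> /IHp IH; rewrite [height_from _ _ _]/= [up_heights _ _]/= mS IH; case: b;
    last by rewrite max0n.
  by rewrite maxnA (maxn_idPr (leqnSn h)).
by case/andP => h0 /IHp IH; rewrite [height_from _ _ _]/= [up_heights _ _]/= IH max0n.
Qed.

Lemma max_seq_mapS c : (0 < size c)%N -> max_seq (map S c) = (max_seq c).+1.
Proof.
have mE x d : max_seq (x :: d) = maxn x (max_seq d) by [].
elim: c => // x [|y c] IHc _; first by rewrite /max_seq /= !maxn0.
by rewrite map_cons mE IHc // maxnSS -mE.
Qed.

Lemma height_up_heights p : dyck p -> (0 < size (up_heights 0 p))%N ->
  height p = (max_seq (up_heights 0 p)).+1.
Proof.
rewrite dyckE => dp sp; rewrite -max_seq_mapS //
  -[RHS]max0n -(height_from_up_heights false dp) -height_from_bigmax //.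
rewrite /height; apply: eq_big => [[[|m] mp]|m _]; rewrite /is_peak /= ?add0r //.
by rewrite mp.
Qed.

Lemma area_up_heights p : dyck p ->
  area p = (size (up_heights 0 p))%:R / 2 + (sumn (up_heights 0 p))%:R.
Proof.
(* An up step from x and its matching down step bound trapezoids of total Euclidean area 2x + 1; the
   h unmatched down steps bound a triangle of area h^2 / 2. *)
suff A h q : dyck_from h q -> \sum_(m < size q) (((h%:Z + ordinate q m)%:~R + (h%:Z +
  ordinate q m.+1)%:~R) / 2 : rat) =
    h%:R ^+ 2 / 2 + ((sumn (up_heights h q)).*2 + size (up_heights h q))%:R.
  rewrite dyckE => /A; rewrite expr0n mul0r add0r /area => Ap.
  rewrite (eq_bigr (fun m : 'I_(size p) =>
    (((0%N%:Z + ordinate p m)%:~R + (0%N%:Z + ordinate p m.+1)%:~R) / 2 : rat))).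
    by rewrite Ap natrD -addnn natrD; field.
  by move=> m _; rewrite !add0r.
have SE k : k.+1%:Z = k%:Z + 1 by rewrite -addn1 PoszD.
elim: q h => [|s q IHq] h; first by move=> /= /eqP ->; rewrite big_ord0 expr0n mul0r.
rewrite big_ord_recl ordinate0 addr0 => dq.
under eq_bigr => m _ do rewrite !ordinateS !addrA.
rewrite !ordinateS !addrA; rewrite [ordinate q 0]ordinate0 addr0.
case: s dq => /= [|/andP[]].
  move=> dq; rewrite -SE IHq // -!pmulrn.
  by rewrite -!addnn !natrD -natr1; field.
case: h => // h _ dq; rewrite SE !addrK IHq // -SE -!pmulrn.
by rewrite !natrD; field.
Qed.

Lemma sumn_heights s : is_col_seq s -> (sumn (heights s) + sumn s = 'C(size s, 2))%N.
Proof.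
elim/last_ind: s => // s x IHs; rewrite is_col_seq_rcons => /andP[/IHs + xs].
rewrite heights_rcons -!cats1 !sumn_cat size_cat /= addn1 binS bin1; lia.
Qed.

(** * Diagonalising a Cartan subalgebra *)

Section AdDiagonalizable.
Variables (F : numClosedFieldType) (n : nat) (H : 'M[F]_n.+1).

Definition adprod (ev : seq F) : 'End('M[F]_n.+1) :=
  foldr (fun c g => ((ad H - c *: \1) \o g)%VF) \1%VF ev.

Lemma adprod_cons c ev X :
  adprod (c :: ev) X = lie_bracket H (adprod ev X) - c *: adprod ev X.
Proof. by rewrite /= comp_lfunE add_lfunE opp_lfunE scale_lfunE id_lfunE adE. Qed.

Lemma adprod_eigen d ev X : lie_bracket H X = d *: X ->
  adprod ev X = (\prod_(c <- ev) (d - c)) *: X.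
Proof.
move=> HX; elim: ev => [|c ev IHev]; first by rewrite big_nil scale1r id_lfunE.
rewrite adprod_cons IHev linearZ /= HX big_cons !scalerA -scalerBl.
by rewrite mulrBl [d * _]mulrC.
Qed.

Lemma adprod_eigen0 d ev X : lie_bracket H X = d *: X -> d \in ev ->
  adprod ev X = 0.
Proof.
by move=> /adprod_eigen-> dev; rewrite (big_rem d) //= subrr mul0r scale0r.
Qed.

(** For a row eigenvector f, the map v |-> v *m f intertwines H - mu with ad H, so
    a polynomial with simple roots killing ad H yields one killing H. *)
Lemma adprod_outer mu (f : 'rV[F]_n.+1) ev (v : 'cV_n.+1) : f *m H = mu *: f ->
  adprod ev (v *m f) =
  horner_mx H (\prod_(c <- ev) ('X - (mu + c)%:P)) *m v *m f.
Proof.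
move=> fH; elim: ev => [|c ev IHev].
  by rewrite big_nil rmorph1 mul1mx id_lfunE.
rewrite adprod_cons IHev big_cons rmorphM rmorphB /= horner_mx_X horner_mx_C.
set A := horner_mx _ _; rewrite -[_ * A]/(_ *m A) /lie_bracket.
rewrite -(mulmxA (A *m v) f H) fH -scalemxAr -!mulmxA mulmxBl mul_scalar_mx.
by rewrite scalerDl opprD addrA.
Qed.

Lemma ad_diagonalizable (s : seq 'M[F]_n.+1) : basis_of (sl F n.+1) s ->
  (forall X, X \in s -> exists c, lie_bracket H X = c *: X) ->
  diagonalizable H.
Proof.
move=> /span_basis sE sH.
have [ev evP] : exists ev : seq F, forall X, X \in s ->
    exists2 c, c \in ev & lie_bracket H X = c *: X.
  elim: s {sE} sH => [|X s IHs] sH; first by exists [::].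
  have [|ev evP] := IHs; first by move=> Y Ys; apply: sH; rewrite inE Ys orbT.
  have [c Xc] := sH X (mem_head _ _).
  exists (c :: ev) => Y; rewrite inE => /orP[/eqP ->|/evP[d dev Yd]].
    by exists c; rewrite ?mem_head.
  by exists d; rewrite // inE dev orbT.
(* The value 0 takes care of the scalar matrices, which complement the traceless ones and are killed
   by ad H; [undup] makes the roots simple. *)
pose ds := undup (0 :: ev).
have ds0 X : adprod ds X = 0.
  have slP : (sl F n.+1 <= lker (adprod ds))%VS.
    rewrite -sE; apply/span_subvP => Y /evP[c cev Yc]; rewrite memv_ker.
    by rewrite (adprod_eigen0 Yc) // mem_undup inE cev orbT.
  have XE : X = (X - (\tr X / n.+1%:R)%:M) + (\tr X / n.+1%:R)%:M by rewrite subrK.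
  rewrite XE linearD /= (eqP (_ : adprod ds (X - _) == 0)); last first.
    rewrite -memv_ker; apply: (subvP slP); rewrite mem_sl linearB /= mxtrace_scalar.
    by rewrite -(mulr_natr (_ / _)) divfK ?subrr // pnatr_eq0.
  rewrite add0r (@adprod_eigen0 0) ?mem_undup ?mem_head // /lie_bracket scale0r.
  by rewrite scalar_mxC subrr.
have [mu /eigenvalueP[f /= fH f0]] := @eigenvalue_closed F _ H isT.
pose rs := [seq mu + c | c <- ds].
apply/diagonalizableP; exists rs.
  by rewrite map_inj_uniq ?undup_uniq //; apply: addrI.
apply: mxminpoly_min; rewrite big_map; set A := horner_mx _ _.
(* With the j-th standard column as v, the product v f is killed by [adprod ds], so column j of A
   times the nonzero row f is 0. *)
apply/matrixP => i j; have := ds0 (delta_mx j 0 *m f).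
rewrite (adprod_outer _ _ fH) -/A => /matrixP Af.
have [k fk] : exists k, f 0 k != 0 by apply/rV0Pn.
have /eqP := Af i k; rewrite -colE !mxE big_ord1 !mxE mulf_eq0 (negPf fk) orbF.
by move/eqP.
Qed.

End AdDiagonalizable.

Section Coordinates.
Variables (F : fieldType) (n : nat) (P : 'M[F]_n).
Hypothesis Pu : P \in unitmx.

Definition coord_mx (X : 'M[F]_n) : 'M[F]_n := P *m X *m invmx P.

Fact coord_mx_is_linear : linear coord_mx.
Proof.
by move=> a X Y; rewrite /coord_mx mulmxDr mulmxDl -scalemxAr -scalemxAl.
Qed.

HB.instance Definition _ :=
  GRing.isLinear.Build F 'M[F]_n 'M[F]_n *:%R coord_mx coord_mx_is_linear.

Definition unit_vec (i j : 'I_n) : 'M[F]_n := invmx P *m delta_mx i j *m P.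

Lemma coord_mxM X Y : coord_mx (X *m Y) = coord_mx X *m coord_mx Y.
Proof. by rewrite /coord_mx !mulmxA mulmxKV. Qed.

Lemma coord_mx_bracket X Y : coord_mx (lie_bracket X Y) =
  lie_bracket (coord_mx X) (coord_mx Y).
Proof. by rewrite /lie_bracket linearB /= !coord_mxM. Qed.

Lemma coord_mxK X : invmx P *m coord_mx X *m P = X.
Proof. by rewrite /coord_mx !mulmxA mulVmx // mul1mx mulmxKV. Qed.

Lemma coord_mx_inj : injective coord_mx.
Proof. by move=> X Y XY; rewrite -[X]coord_mxK XY coord_mxK. Qed.

Lemma coord_mx_conj X : coord_mx (invmx P *m X *m P) = X.
Proof. by rewrite /coord_mx !mulmxA mulmxV // mul1mx mulmxK. Qed.

Lemma coord_mx_unit_vec i j : coord_mx (unit_vec i j) = delta_mx i j.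
Proof. exact: coord_mx_conj. Qed.

Lemma mxtrace_coord_mx X : \tr (coord_mx X) = \tr X.
Proof. by rewrite /coord_mx mxtrace_mulC mulmxA mulVmx // mul1mx. Qed.

Lemma unit_vec_sum X : X = \sum_i \sum_j coord_mx X i j *: unit_vec i j.
Proof.
apply: coord_mx_inj; rewrite [LHS]matrix_sum_delta linear_sum; apply: eq_bigr => i _.
rewrite linear_sum; apply: eq_bigr => j _.
by rewrite [RHS]linearZ /= coord_mx_unit_vec.
Qed.

Lemma unit_vec_bracket i j k l :
  lie_bracket (unit_vec i j) (unit_vec k l) =
  (j == k)%:R *: unit_vec i l - (l == i)%:R *: unit_vec k j.
Proof.
apply: coord_mx_inj; rewrite coord_mx_bracket linearB !linearZ /= !coord_mx_unit_vec
  /lie_bracket.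
by rewrite !mul_delta_mx_cond scalerN !scaler_nat.
Qed.

Lemma coord_mx_bracketE X Y i j :
  coord_mx (lie_bracket X Y) i j =
    \sum_k (coord_mx X i k * coord_mx Y k j - coord_mx Y i k * coord_mx X k j).
Proof. by rewrite coord_mx_bracket /lie_bracket !mxE sumrB. Qed.

Lemma coord_mx_bracket_diag X Y i j : (forall k l, k != l -> coord_mx X k l = 0) ->
  coord_mx (lie_bracket X Y) i j = (coord_mx X i i - coord_mx X j j) * coord_mx Y i j.
Proof.
move=> Xd; rewrite coord_mx_bracketE sumrB (bigD1 i) //= big1 ?addr0; last first.
  by move=> k ki; rewrite Xd ?mul0r // eq_sym.
rewrite (bigD1 j) //= big1 ?addr0; last by move=> k kj; rewrite Xd ?mulr0.
by rewrite mulrBl [X in _ - X]mulrC.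
Qed.

End Coordinates.

(** Elements of h centralise h, so a basis of h is a commuting family of diagonalisable matrices and
    can be diagonalised simultaneously. Conversely a traceless diagonal matrix commutes with all of
    h, and h is self-centralising. *)
Lemma cartan_diag (F : numClosedFieldType) (n : nat) (h : {vspace 'M[F]_n.+1}) :
  cartan_subalgebra h -> exists2 P, P \in unitmx &
  forall X, X \in h <-> \tr X = 0 /\ forall i j, i != j -> coord_mx P X i j = 0.
Proof.
case=> h_sl h_cent h_diag.
have : codiagonalizable (vbasis h : seq _).
  apply/codiagonalizableP; split=> [A B /vbasis_mem Ah /vbasis_mem Bh|A /vbasis_mem Ah].
    apply/subr0_eq; apply: (h_cent B _).1 => //; exact: (subvP h_sl).
  by have [s sb sA] := h_diag A Ah; exact: ad_diagonalizable sb sA.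
case=> P Pu /allP PD; exists P => //.
have hD X : X \in h -> forall i j, i != j -> coord_mx P X i j = 0.
  move=> Xh i j ij; rewrite (coord_vbasis Xh) linear_sum summxE.
  apply: big1 => k _; rewrite linearZ /= mxE.
  have /PD/diagonalizable_forPp : (vbasis h)`_k \in vbasis h.
    by rewrite mem_nth ?size_tuple.
  by move=> /(_ i j ij); rewrite mxpoly.conjumx // -[_ *m _]/(coord_mx P _) => ->;
    rewrite mulr0.
move=> X; split=> [Xh|[X0 XD]].
  by split; [apply/eqP; rewrite -mem_sl; exact: (subvP h_sl) | exact: hD].
have Xsl : X \in sl F n.+1 by rewrite mem_sl X0.
apply/(h_cent X Xsl) => Y Yh; apply: (coord_mx_inj Pu); rewrite linear0.
apply/matrixP => i j; rewrite (coord_mx_bracket_diag Pu _ _ _ (hD Y Yh)) [RHS]mxE.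
have [->|ij] := eqVneq i j; first by rewrite subrr mul0r.
by rewrite XD ?mulr0.
Qed.

(** * Roots and positive systems *)

Section SpanUnits.
Variables (F : fieldType) (n : nat) (P : 'M[F]_n).
Hypothesis Pu : P \in unitmx.

Definition unit_span (S : {set 'I_n * 'I_n}) : {vspace 'M[F]_n} :=
  <<[seq unit_vec P q.1 q.2 | q <- enum S]>>%VS.

Lemma unit_vec_span (S : {set 'I_n * 'I_n}) i j : (i, j) \in S ->
  unit_vec P i j \in unit_span S.
Proof. by move=> ijS; apply/memv_span/mapP; exists (i, j); rewrite ?mem_enum. Qed.

Lemma mem_unit_span S X :
  (X \in unit_span S) <-> (forall i j, (i, j) \notin S -> coord_mx P X i j = 0).
Proof.
split=> [XS i j ijS|XS].
  pose f : 'M[F]_n -> F^o := fun Y => coord_mx P Y i j.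
  have fl : linear f by move=> a Y Z; rewrite /f linearD linearZ /= !mxE.
  pose fL := HB.pack_for {linear 'M[F]_n -> F^o} f (GRing.isLinear.Build F 'M[F]_n F^o
    *:%R f fl).
  have : X \in lker (linfun fL).
    apply: (subvP _ _ XS); apply/span_subvP => Y /mapP[[k l]];
      rewrite mem_enum => kl ->.
    rewrite memv_ker lfunE /= /f coord_mx_unit_vec // mxE.
    have [ik|//] := eqVneq i k; have [jl|//] := eqVneq j l.
    by rewrite ik jl kl in ijS.
  by rewrite memv_ker lfunE => /eqP.
rewrite (unit_vec_sum Pu X); apply: memv_suml => i _; apply: memv_suml => j _.
have [ijS|ijS] := boolP ((i, j) \in S); first exact/memvZ/unit_vec_span.
by rewrite XS // scale0r mem0v.
Qed.

Lemma dim_unit_span S : \dim (unit_span S) = #|S|.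
Proof.
rewrite /unit_span; set s := map _ _; suff /eqP -> : free s by rewrite size_map cardE.
rewrite -[s]in_tupleE; apply/freeP => k k0 q.
have ts : size s = #|S| by rewrite size_map cardE.
have qS : (q < size (enum S))%N by rewrite -cardE -ts.
have sE (r : 'I_(size s)) x0 : (in_tuple s)`_r =
  unit_vec P (nth x0 (enum S) r).1 (nth x0 (enum S) r).2.
  by rewrite in_tupleE (nth_map x0) // -cardE -ts.
have [x0] : {x0 | x0 \in S} by exists (tnth (in_tuple (enum S)) (Ordinal qS));
  rewrite -mem_enum mem_tnth.
move=> _; have := congr1 (coord_mx P) k0; rewrite linear_sum linear0.
move/matrixP/(_ (nth x0 (enum S) q).1 (nth x0 (enum S) q).2); rewrite summxE.
rewrite (bigD1 q) //= big1 => [|r rq].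
  by rewrite linearZ /= (sE _ x0) coord_mx_unit_vec // !mxE !eqxx mulr1 addr0.
rewrite linearZ /= (sE _ x0) coord_mx_unit_vec // !mxE.
have [e1|_] := eqVneq _ (nth x0 (enum S) r).1; last by rewrite mulr0.
have [e2|_] := eqVneq _ (nth x0 (enum S) r).2; last by rewrite mulr0.
have : nth x0 (enum S) q = nth x0 (enum S) r.
  by rewrite [LHS]surjective_pairing e1 e2 -surjective_pairing.
move/eqP; rewrite nth_uniq ?enum_uniq // -?cardE -?ts //.
by move=> /eqP/val_inj qr; rewrite qr eqxx in rq.
Qed.

Lemma mxtrace_unit_vec i j : \tr (unit_vec P i j) = (i == j)%:R.
Proof.
rewrite -(mxtrace_coord_mx Pu) coord_mx_unit_vec //
  /mxtrace (bigD1 i) //= big1 ?addr0 ?mxE ?eqxx //.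
by move=> k ki; rewrite mxE (negPf ki).
Qed.

End SpanUnits.

(** Parity decides which exponents are 0, and if none is, both sides are halved. The condition i <>
    j excludes the solutions with i = j and k = l. *)
Lemma pow2_sub_inj (i j k l : nat) : i <> j ->
  (2 ^ i + 2 ^ l = 2 ^ k + 2 ^ j)%N -> i = k /\ l = j.
Proof.
have e2 a b : (2 ^ a = 2 ^ b)%N -> a = b by apply: expnI.
elim: i j k l => [|i IHi] [|j] [|k] [|l] //; rewrite ?expnS ?expn0 => ij E; try lia.
- by split=> //; congr S; apply: e2; lia.
- by split=> //; congr S; apply: e2; lia.
- by case: ij; congr S; apply: e2; lia.
- by have [] := IHi j k l; [move=> e; apply: ij; rewrite e|lia|move=> -> ->].
Qed.

Section Generic.
Variables (F : numClosedFieldType) (n : nat) (P : 'M[F]_n.+1).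
Hypothesis Pu : P \in unitmx.

(** Distinct pairs i <> j have distinct differences 2^i - 2^j, so the roots are
    separated by the values at this element. *)
Definition generic : 'M[F]_n.+1 :=
  invmx P *m diag_mx (\row_i ((2 ^ i)%:R
    - (\sum_(k < n.+1) (2 ^ k)%:R) / n.+1%:R)) *m P.

Lemma generic_diag i j : i != j -> coord_mx P generic i j = 0.
Proof. by move=> ij; rewrite coord_mx_conj // !mxE (negPf ij). Qed.

Lemma generic_tr : \tr generic = 0.
Proof.
rewrite -(mxtrace_coord_mx Pu) coord_mx_conj // mxtrace_diag.
under eq_bigr => i _ do rewrite mxE.
by rewrite sumrB sumr_const card_ord -(mulr_natr (_ / _)) divfK ?subrr // pnatr_eq0.
Qed.

Lemma generic_sub i j : coord_mx P generic i i - coord_mx P generic j j =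
  (2 ^ i)%:R - (2 ^ j)%:R.
Proof. by rewrite coord_mx_conj // !mxE !eqxx !mulr1n opprB addrA addrNK. Qed.

Lemma generic_sep (i j k l : 'I_n.+1) : i != j ->
  coord_mx P generic i i - coord_mx P generic j j =
    coord_mx P generic k k - coord_mx P generic l l ->
  i = k /\ j = l.
Proof.
move=> ij; rewrite !generic_sub => E.
have /eqP : ((2 ^ i + 2 ^ l)%N%:R : F) = (2 ^ k + 2 ^ j)%N%:R.
  by apply/eqP; rewrite !natrD; move/eqP: E; rewrite subr_eq => /eqP ->;
    rewrite addrAC subrK.
rewrite eqr_nat => /eqP/pow2_sub_inj[|/val_inj -> /val_inj -> //].
by move/val_inj => e; rewrite e eqxx in ij.
Qed.

End Generic.

Section Roots.
Variables (F : numClosedFieldType) (n : nat) (P : 'M[F]_n.+1).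
Variable h : {vspace 'M[F]_n.+1}.

Definition diag_root_fun (i j : 'I_n.+1) (H : subvs_of h) : F^o :=
  coord_mx P (vsval H) i i - coord_mx P (vsval H) j j.

Fact diag_root_is_linear i j : linear (diag_root_fun i j).
Proof.
move=> a X Y; rewrite /diag_root_fun !linearP /= !mxE.
by rewrite scalerBr opprD addrACA.
Qed.

HB.instance Definition _ i j :=
  GRing.isLinear.Build F (subvs_of h) F^o *:%R (diag_root_fun i j)
    (diag_root_is_linear i j).

Definition diag_root (i j : 'I_n.+1) : 'Hom(subvs_of h, F^o) :=
  linfun (diag_root_fun i j).

Lemma diag_rootE i j H :
  diag_root i j H = coord_mx P (vsval H) i i - coord_mx P (vsval H) j j.
Proof. by rewrite lfunE. Qed.

Hypothesis Pu : P \in unitmx.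
Hypothesis hP : forall X,
  X \in h <-> \tr X = 0 /\ forall i j, i != j -> coord_mx P X i j = 0.

Lemma generic_in_h : generic P \in h.
Proof. by apply/hP; split; [exact: generic_tr|exact: generic_diag]. Qed.

Lemma h_diag (H : subvs_of h) i j : i != j -> coord_mx P (vsval H) i j = 0.
Proof. by have /hP[_] := subvsP H; apply. Qed.

(** A diagonal H scales entry (i, j) by the difference of its diagonal entries, so a single nonzero
    entry already determines the eigenvalue. In particular every root is some [diag_root i j]. *)
Lemma root_space_entry alpha X i j : X \in root_space alpha ->
  coord_mx P X i j != 0 -> alpha = diag_root i j.
Proof.
case/root_spaceP => _ XH x0; apply/lfunP => H; rewrite diag_rootE.
have := congr1 (fun Y => coord_mx P Y i j) (XH H).
rewrite (coord_mx_bracket_diag Pu _ _ _ (h_diag H)) linearZ /= [RHS]mxE.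
by move=> E; apply/esym; apply: (mulIf x0).
Qed.

Lemma unit_vec_root_space i j : i != j -> unit_vec P i j \in root_space (diag_root i j).
Proof.
move=> ij; apply/root_spaceP; split;
  first by rewrite mem_sl mxtrace_unit_vec // (negPf ij).
move=> H; apply: (coord_mx_inj Pu); apply/matrixP => k l.
rewrite (coord_mx_bracket_diag Pu _ _ _ (h_diag H)) linearZ /= diag_rootE
  coord_mx_unit_vec // !mxE.
have [->|_] := eqVneq k i; last by rewrite !mulr0.
by have [->|_] := eqVneq l j; last by rewrite !mulr0.
Qed.

Lemma diag_root_is_root i j : i != j -> is_root (diag_root i j).
Proof.
move=> ij; apply/andP; split.
  apply/eqP => /lfunP/(_ (Subvs generic_in_h)); rewrite diag_rootE /= lfunE /=.
  move=> E.
  (* A root vanishing at [generic P] would take the same value there as the pair (j, j), which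
     forces i = j. *)
  have [|ij' _] := @generic_sep _ _ _ Pu i j j j ij; first by rewrite subrr.
  by rewrite ij' eqxx in ij.
apply/eqP => r0; have := unit_vec_root_space ij;
  rewrite r0 memv0 => /eqP/(congr1 (coord_mx P)).
rewrite coord_mx_unit_vec // linear0 => /matrixP/(_ i j); rewrite !mxE !eqxx => /eqP.
by rewrite oner_eq0.
Qed.

Lemma diag_rootii i : diag_root i i = 0.
Proof. by apply/lfunP => H; rewrite diag_rootE subrr lfunE. Qed.

Lemma diag_rootN i j : - diag_root i j = diag_root j i.
Proof. by apply/lfunP => H; rewrite opp_lfunE !diag_rootE opprB. Qed.

Lemma diag_rootD i j k : diag_root i j + diag_root j k = diag_root i k.
Proof. by apply/lfunP => H; rewrite add_lfunE !diag_rootE addrA subrK. Qed.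

Variable Pos : seq 'Hom(subvs_of h, F^o).
Hypothesis PosP : positive_system Pos.

Let below (i j : 'I_n.+1) := diag_root i j \in Pos.

Lemma below_irr i : below i i = false.
Proof.
by case: PosP => rt _ _; apply/negP => /rt; rewrite diag_rootii /is_root eqxx.
Qed.

Lemma below_total i j : i != j -> below j i = ~~ below i j.
Proof.
by case: PosP => _ op _ ij; rewrite /below -diag_rootN op // diag_root_is_root.
Qed.

(** For i <> k this is closure of the positive system under sums that are roots; i = k would make a
    root and its opposite both positive. *)
Lemma below_trans : transitive below.
Proof.
move=> j i k ij jk; have [ik|ik] := eqVneq i k.
  have [jk'|jk'] := eqVneq j k; first by rewrite jk' below_irr in jk.
  by move: ij; rewrite ik (below_total jk') jk.
case: PosP => _ _ cl; rewrite /below -(diag_rootD i j k); apply: cl => //.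
by rewrite diag_rootD diag_root_is_root.
Qed.

Definition rank_of (i : 'I_n.+1) : nat := #|[set k | below k i]|.

Lemma rank_lt i j : below i j -> (rank_of i < rank_of j)%N.
Proof.
move=> ij; apply: proper_card; apply/properP; split.
  by apply/fintype.subsetP => k; rewrite !inE => ki; exact: below_trans ki ij.
by exists i; rewrite !inE ?below_irr.
Qed.

Lemma rank_of_bound i : (rank_of i < n.+1)%N.
Proof.
rewrite -[X in (_ < X)%N]card_ord -cardsT; apply: proper_card.
by apply/properP; split; [exact: finset.subsetT | exists i; rewrite !inE ?below_irr].
Qed.

Lemma below_rank i j : below i j = (rank_of i < rank_of j)%N.
Proof.
have [->|ij] := eqVneq i j; first by rewrite below_irr ltnn.
case bij: (below i j); first by rewrite rank_lt.
have : below j i by rewrite below_total ?bij.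
by move/rank_lt => /ltnW; rewrite leqNgt => /negPf.
Qed.

Let rk (i : 'I_n.+1) : 'I_n.+1 := Ordinal (rank_of_bound i).

Lemma rk_inj : injective rk.
Proof.
move=> i j /(congr1 val) /= ij; apply/eqP/negPn/negP => ne.
have := below_total ne; by rewrite !below_rank ij ltnn.
Qed.

(** Reordering the coordinates of P by [rank_of] turns [below] into the usual order of the indices,
    hence positive roots into positions above the diagonal. *)
Lemma borel_upper : exists2 Q, Q \in unitmx &
  forall X, X \in borel Pos <->
    \tr X = 0 /\ forall i j : 'I_n.+1, (j < i)%N -> coord_mx Q X i j = 0.
Proof.
pose s : {perm 'I_n.+1} := perm rk_inj.
pose Q := perm_mx s^-1 *m P.
have Qu : Q \in unitmx by rewrite unitmx_mul unitmx_perm.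
have QV : invmx Q = invmx P *m perm_mx s.
  have Q1 : Q *m (invmx P *m perm_mx s) = 1%:M.
    by rewrite /Q -mulmxA (mulmxA P) mulmxV // mul1mx -perm_mxM mulVg perm_mx1.
  by rewrite -[LHS]mulmx1 -Q1 mulKmx.
exists Q => //.
have QE X i j : coord_mx Q X i j = coord_mx P X (s^-1 i)%g (s^-1 j)%g.
  have -> : coord_mx Q X = row_perm s^-1 (col_perm s^-1 (coord_mx P X)).
    by rewrite row_permE col_permE invgK /coord_mx QV /Q !mulmxA.
  by rewrite [LHS]mxE [LHS]mxE.
have upE X : (forall i j : 'I_n.+1, (j < i)%N -> coord_mx Q X i j = 0) <->
    (forall i j, i != j -> ~~ below i j -> coord_mx P X i j = 0).
  split=> X0 i j ij.
    move=> nij; have : below j i by rewrite below_total.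
    rewrite below_rank => /(X0 (rk i) (rk j)); rewrite QE.
    have sE k : (s^-1 (rk k))%g = k by rewrite -[rk k]/(rk k) -(permE rk_inj) permK.
    by rewrite !sE.
  have sE k : (rank_of (s^-1 k)%g = k :> nat)%N.
    by have /(congr1 val) := permKV s k; rewrite permE.
  rewrite QE X0 // ?below_rank ?sE -?leqNgt ?(ltnW ij) //.
  by rewrite (inj_eq perm_inj); apply: contraTneq ij => ->; rewrite ltnn.
move=> X; rewrite upE; split=> [XB|[X0 XU]].
  pose S := [set q : 'I_n.+1 * 'I_n.+1 | (q.1 == q.2) || below q.1 q.2].
  have : X \in (sl F n.+1 :&: unit_span P S)%VS.
    apply: subvP XB; rewrite subv_add; apply/andP; split.
      apply/subvP => Y /hP[Y0 YD]; rewrite memv_cap mem_sl Y0 eqxx /=.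
      by apply/mem_unit_span => // i j; rewrite inE negb_or => /andP[/YD].
    rewrite big_seq; apply: (big_ind (fun U => (U <= _)%VS)).
    - exact: sub0v.
    - by move=> U V; rewrite subv_add => -> ->.
    move=> alpha aPos; apply/subvP => Y Ya; rewrite memv_cap.
    have /root_spaceP[-> _] := Ya; apply/mem_unit_span => // i j.
    rewrite inE negb_or => /andP[ij nij]; apply: contraNeq nij => y0.
    by rewrite /below -(root_space_entry Ya y0).
  rewrite memv_cap mem_sl => /andP[/eqP X0 /(mem_unit_span Pu) XS];
    split=> // i j ij nij.
  by apply: XS; rewrite inE negb_or ij.
(* O is the off-diagonal part of X: X - O is diagonal and traceless, hence in h, and each nonzero
   term of O lies in a positive root space. *)
pose O := \sum_i \sum_(j | i != j) coord_mx P X i j *: unit_vec P i j.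
have OE : X = (X - O) + O by rewrite subrK.
rewrite OE; apply: memv_add.
  apply/hP; split.
    rewrite linearB /= X0 linear_sum big1 ?subrr // => i _.
    rewrite linear_sum big1 // => j ij.
    by rewrite linearZ /= mxtrace_unit_vec // (negPf ij) mulr0.
  have -> : X - O = \sum_i coord_mx P X i i *: unit_vec P i i.
    apply/eqP; rewrite subr_eq {1}(unit_vec_sum Pu X) -big_split /=; apply/eqP.
    apply: eq_bigr => i _; rewrite (bigD1 i) //=; congr (_ + _).
    by apply: eq_bigl => j; rewrite eq_sym.
  move=> k l kl; rewrite linear_sum summxE big1 // => i _.
  rewrite linearZ /= coord_mx_unit_vec // [LHS]mxE [X in _ * X]mxE.
  have [ki|_] := eqVneq k i; last by rewrite mulr0.
  have [li|_] := eqVneq l i; last by rewrite mulr0.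
  by rewrite ki li eqxx in kl.
apply: memv_suml => i _; apply: memv_suml => j ij.
have [bij|nij] := boolP (below i j); last by rewrite XU ?scale0r ?mem0v.
apply: memvZ; rewrite (big_rem _ bij) /=.
by apply: (subvP (addvSl _ _)); exact: unit_vec_root_space.
Qed.

End Roots.

(** * Ideals of the Borel subalgebra *)

Lemma card_ord_lt N m : (m <= N)%N -> #|[set i : 'I_N | (i < m)%N]| = m.
Proof.
move=> mN; rewrite -sum1_card (eq_bigl (fun i : 'I_N => true && (i < m)%N)); last first.
  by move=> i; rewrite inE.
by rewrite (big_ord_narrow_cond mN) sum1_card card_ord.
Qed.

Lemma down_closed_card N (T : {set 'I_N}) :
  (forall i j : 'I_N, (i <= j)%N -> j \in T -> i \in T) ->
  forall i, (i \in T) = (i < #|T|)%N.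
Proof.
move=> dT i; apply/idP/idP => [iT|].
  rewrite -[X in (X <= _)%N](@card_ord_lt N) // subset_leq_card //.
  by apply/fintype.subsetP => k; rewrite inE ltnS => ki; exact: dT iT.
apply: contraLR => iT; rewrite -leqNgt -[X
  in (_ <= X)%N](card_ord_lt (ltnW (ltn_ord i))).
apply: subset_leq_card; apply/fintype.subsetP => k kT; rewrite inE ltnNge.
by apply: contra iT => ik; exact: dT kT.
Qed.

Section Ideals.
Variables (F : numClosedFieldType) (n : nat) (P : 'M[F]_n.+1).
Variable b : {vspace 'M[F]_n.+1}.
Hypothesis Pu : P \in unitmx.
Hypothesis hb : forall X, X \in b <->
  \tr X = 0 /\ forall i j : 'I_n.+1, (j < i)%N -> coord_mx P X i j = 0.

Lemma unit_vec_borel (i j : 'I_n.+1) : (i < j)%N -> unit_vec P i j \in b.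
Proof.
move=> ij; apply/hb; split.
  by rewrite mxtrace_unit_vec // -val_eqE ltn_eqF.
move=> k l lk; rewrite coord_mx_unit_vec // mxE; have [ki|//] := eqVneq k i.
by have [lj|//] := eqVneq l j; move: ij; rewrite -ki -lj ltnNge ltnW.
Qed.

Lemma iter_bracket_outer (X : 'M[F]_n.+1) (mu : F) (f : 'rV_n.+1) (v : 'cV_n.+1) k :
  f *m X = mu *: f ->
  iter k (lie_bracket X) (v *m f) = iter k (mulmx (X - mu%:M)) v *m f.
Proof.
move=> fX; elim: k => //= k ->; set w := iter _ _ _.
rewrite /lie_bracket -(mulmxA w) fX -scalemxAr !mulmxA !mulmxBl mul_scalar_mx.
by rewrite -scalemxAl.
Qed.

(** With f the last coordinate row, a row eigenvector of X for mu, nilpotency of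
    ad X on the matrices v *m f makes X - mu nilpotent, so mu is the only
    diagonal entry; the trace gives mu = 0. *)
Lemma ad_nilpotent_strict X : X \in b -> ad_nilpotent X ->
  forall i j : 'I_n.+1, (j <= i)%N -> coord_mx P X i j = 0.
Proof.
move=> /hb[X0 XU] [m Xm].
have PX : P *m X = coord_mx P X *m P by rewrite /coord_mx mulmxKV.
pose mu := coord_mx P X ord_max ord_max;
  pose f := delta_mx (0 : 'I_1) (@ord_max n) *m P.
have fX : f *m X = mu *: f.
  rewrite /f -mulmxA PX mulmxA -rowE scalemxAl; congr (_ *m _).
  apply/rowP => j; rewrite [LHS]mxE [RHS]mxE [X in _ * X]mxE eqxx /=.
  have [->|jm] := eqVneq j ord_max; first by rewrite mulr1.
  by rewrite mulr0 XU // ltn_neqAle jm /= -ltnS.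
have f0 : f != 0.
  apply/eqP => /(congr1 (mulmxr (invmx P))) /=; rewrite mulmxK // mul0mx.
  by move/matrixP/(_ 0 ord_max)/eqP; rewrite !mxE !eqxx oner_eq0.
have diag i : coord_mx P X i i = mu.
  pose v := invmx P *m delta_mx i (0 : 'I_1).
  (* Since X - mu is upper triangular, the coordinates after i stay 0, and coordinate i is
     multiplied by X_ii - mu at every step. *)
  have wk k : (forall j : 'I_n.+1, (i < j)%N ->
        (P *m iter k (mulmx (X - mu%:M)) v) j 0 = 0) /\
      (P *m iter k (mulmx (X - mu%:M)) v) i 0 = (coord_mx P X i i - mu) ^+ k.
    elim: k => [|k [IH0 IHi]].
      split=> [j ij|]; rewrite /= mulKVmx // mxE ?eqxx //.
      by rewrite -val_eqE gtn_eqF.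
    have PA w : P *m ((X - mu%:M) *m w) = (coord_mx P X - mu%:M) *m (P *m w).
      by rewrite mulmxA mulmxBr PX scalar_mxC -mulmxBl -mulmxA.
    split=> [j ij|]; rewrite iterS PA mxE.
      apply: big1 => l _; case: (ltnP i l) => [/IH0 ->|li]; first by rewrite mulr0.
      rewrite [X in X * _]mxE XU ?(leq_ltn_trans li) // !mxE -val_eqE.
      by rewrite gtn_eqF ?(leq_ltn_trans li) // mulr0n oppr0 addr0 mul0r.
    rewrite (bigD1 i) //= big1 ?addr0 => [|l li].
      by rewrite IHi exprS [X in X * _]mxE [X in (_ + X) * _]mxE
        [X in (_ - X) * _]mxE eqxx.
    case: (ltngtP i l) => [/IH0 ->|li'|/val_inj il]; first by rewrite mulr0.
      rewrite [X in X * _]mxE XU // [X in (_ + X) * _]mxE [X in (_ - X) * _]mxE.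
      by rewrite eq_sym (negPf li) mulr0n oppr0 addr0 mul0r.
    by rewrite il eqxx in li.
  have [k fk] : exists k, f 0 k != 0 by apply/rV0Pn.
  (* The product v f may have nonzero trace, so the nilpotency assumption on sl is applied to its
     first bracket with X. *)
  have : iter m.+1 (lie_bracket X) (v *m f) = 0.
    rewrite iterSr; apply: Xm; rewrite mem_sl /lie_bracket linearB /= mxtrace_mulC.
    by rewrite subrr.
  rewrite (iter_bracket_outer _ _ fX) => /(congr1 (mulmx P)); rewrite mulmxA mulmx0.
  move/matrixP/(_ i k)/eqP; rewrite mxE big_ord1 (wk m.+1).2 [X in _ == X]mxE.
  by rewrite mulf_eq0 (negPf fk) orbF expf_eq0 /= subr_eq0 => /eqP.
have mu0 : mu = 0.
  have /eqP := X0; rewrite -(mxtrace_coord_mx Pu) /mxtrace (eq_bigr (fun=> mu)) =>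
    [|i _]; last exact: diag.
  by rewrite sumr_const card_ord mulrn_eq0 /= => /eqP.
move=> i j; rewrite leq_eqVlt => /orP[/eqP/val_inj ->|/XU //].
by rewrite diag.
Qed.

Variable I : {vspace 'M[F]_n.+1}.
Hypothesis II : ad_nilpotent_ideal b I.

Lemma generic_borel : generic P \in b.
Proof.
apply/hb; split; first exact: generic_tr.
by move=> i j ij; apply: generic_diag => //; rewrite -val_eqE gtn_eqF.
Qed.

Lemma ideal_strict X (i j : 'I_n.+1) : X \in I -> (j <= i)%N -> coord_mx P X i j = 0.
Proof.
case: II => Ib _ nI XI; apply: ad_nilpotent_strict; last exact: nI.
exact: (subvP Ib).
Qed.

(** Lagrange interpolation in ad of the generic element projects onto a root
    space. *)
Lemma ideal_component X (i j : 'I_n.+1) : X \in I -> coord_mx P X i j != 0 ->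
  unit_vec P i j \in I.
Proof.
move=> XI x0; have ij : (i < j)%N.
  by rewrite ltnNge; apply: contra x0 => /(ideal_strict XI) ->.
pose lam (q : 'I_n.+1 * 'I_n.+1) :=
  coord_mx P (generic P) q.1 q.1 - coord_mx P (generic P) q.2 q.2.
pose op L := foldr (fun q Y => lie_bracket (generic P) Y - lam q *: Y) X L.
have opI L : op L \in I.
  elim: L => //= q L IHL; apply: memvB; last exact: memvZ.
  by case: II => _ bI _; apply: bI => //; exact: generic_borel.
have opE L k l : coord_mx P (op L) k l =
  (\prod_(q <- L) (lam (k, l) - lam q)) * coord_mx P X k l.
  elim: L => [|q L IHL]; first by rewrite big_nil mul1r.
  rewrite big_cons /= linearB linearZ /= [LHS]mxE.
  rewrite (coord_mx_bracket_diag Pu _ _ _ (@generic_diag _ _ _ Pu)).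
  rewrite [X in _ + X]mxE [X in _ - X]mxE IHL -/(lam (k, l)); ring.
(* Diagonal pairs are included: every entry of [op L] other than (i, j) is killed, and [generic_sep]
   keeps the remaining one nonzero because i <> j. *)
pose L := [seq q <- enum {: 'I_n.+1 * 'I_n.+1} | q != (i, j)].
have opL : op L = coord_mx P (op L) i j *: unit_vec P i j.
  apply: (coord_mx_inj Pu); apply/matrixP => k l;
    rewrite linearZ /= coord_mx_unit_vec // [RHS]mxE.
  rewrite [X in _ * X]mxE; have [/andP[/eqP -> /eqP ->]|kl] :=
    boolP ((k == i) && (l == j)).
    by rewrite mulr1.
  rewrite mulr0 opE (big_rem (k, l)) /= ?subrr ?mul0r //.
  by rewrite mem_filter mem_enum andbT; apply: contra kl => /eqP[-> ->]; rewrite !eqxx.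
have c0 : coord_mx P (op L) i j != 0.
  rewrite opE mulf_neq0 // prodf_seq_neq0; apply/allP => -[k l] /=.
  rewrite mem_filter => /andP[klij _]; apply: contra klij; rewrite subr_eq0 => /eqP E.
  have [||-> ->] := @generic_sep _ _ _ Pu i j k l; rewrite ?eqxx //.
  by rewrite -val_eqE ltn_eqF.
by rewrite -(scalerK c0 (unit_vec P i j)) -opL memvZ.
Qed.

Lemma ideal_unit_span : I = unit_span P [set q | unit_vec P q.1 q.2 \in I].
Proof.
apply/vspaceP => X; apply/idP/idP => XI.
  apply/mem_unit_span => // i j; rewrite inE /=; apply: contraNeq;
    exact: ideal_component.
apply: subvP XI; apply/span_subvP => Y /mapP[q]; rewrite mem_enum inE => qI ->.
exact: qI.
Qed.

Lemma ideal_unit_vec_lt (i j : 'I_n.+1) : unit_vec P i j \in I -> (i < j)%N.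
Proof.
move=> ijI; rewrite ltnNge; apply/negP => /(ideal_strict ijI);
  rewrite coord_mx_unit_vec //.
by rewrite mxE !eqxx => /eqP; rewrite oner_eq0.
Qed.

(** Bracketing with the unit at (i', i) replaces the row i by i', and bracketing with the unit at
    (j, j') replaces the column j by j' up to sign. The other term of each bracket vanishes since i
    < j. *)
Lemma ideal_up (i i' j j' : 'I_n.+1) : (i' <= i)%N -> (j <= j')%N ->
  unit_vec P i j \in I -> unit_vec P i' j' \in I.
Proof.
move=> i'i jj' ijI; have ij := ideal_unit_vec_lt ijI; case: (II) => _ bI _.
have i'jI : unit_vec P i' j \in I.
  have [->//|ne] := eqVneq i' i.
  have ii : (i' < i)%N by rewrite ltn_neqAle ne.
  have := bI _ _ (unit_vec_borel ii) ijI; rewrite unit_vec_bracket // eqxx.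
  by rewrite -[j == i']val_eqE gtn_eqF ?(ltn_trans ii) // scale1r scale0r subr0.
have [<-//|ne] := eqVneq j j'.
have jj : (j < j')%N by rewrite ltn_neqAle ne.
have := bI _ _ (unit_vec_borel jj) i'jI; rewrite unit_vec_bracket // eqxx.
rewrite -[j' == i']val_eqE gtn_eqF ?(leq_ltn_trans i'i) ?(ltn_trans ij) //.
by rewrite scale1r scale0r sub0r rpredN.
Qed.

Definition col_ideal (s : seq nat) :=
  unit_span P [set q : 'I_n.+1 * 'I_n.+1 | (q.1 < nth 0 s q.2)%N].

Lemma ideal_col_seq : exists2 s, s \in col_seqs n.+1 & I = col_ideal s.
Proof.
pose T (j : 'I_n.+1) := [set i | unit_vec P i j \in I].
pose s := [seq #|T j| | j <- enum 'I_n.+1].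
have ss : size s = n.+1 by rewrite size_map size_enum_ord.
have sE (j : 'I_n.+1) : nth 0%N s j = #|T j|.
  by rewrite (nth_map j) ?size_enum_ord // nth_ord_enum.
have TE (j i : 'I_n.+1) : (i \in T j) = (i < nth 0 s j)%N.
  rewrite sE; apply: down_closed_card => k l kl; rewrite !inE.
  exact: ideal_up.
exists s; last first.
  by rewrite ideal_unit_span; congr unit_span; apply/setP => -[i j];
    rewrite !inE /= -TE inE.
rewrite mem_col_seqs ss eqxx andTb /is_col_seq; apply/andP; split.
  have ps u : sorted leq u -> path leq 0%N u by case: u.
  apply: ps.
  apply/(sortedP 0%N) => j; rewrite ss => jn.
  have j1 : (j < n.+1)%N by apply: ltnW.
  rewrite -[j.+1]/(val (Ordinal jn)) -[X in (nth _ _ X <= _)%N]/(val (Ordinal j1)) !sE.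
  apply: subset_leq_card; apply/fintype.subsetP => i; rewrite !inE;
    apply: ideal_up => //=.
apply/allP => j; rewrite mem_iota ss => /= jn.
rewrite -[j]/(val (Ordinal jn)) sE -[X in (_ <= X)%N](@card_ord_lt n.+1) ?(ltnW jn) //.
apply: subset_leq_card; apply/fintype.subsetP => i; rewrite !inE;
  exact: ideal_unit_vec_lt.
Qed.

End Ideals.

Section IdealOfSeq.
Variables (F : numClosedFieldType) (n : nat) (P : 'M[F]_n.+1).
Variable b : {vspace 'M[F]_n.+1}.
Hypothesis Pu : P \in unitmx.
Hypothesis hb : forall X, X \in b <->
  \tr X = 0 /\ forall i j : 'I_n.+1, (j < i)%N -> coord_mx P X i j = 0.
Variable s : seq nat.
Hypothesis sN : s \in col_seqs n.+1.

Let ss : size s = n.+1. Proof. by move: sN; rewrite mem_col_seqs => /andP[/eqP]. Qed.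
Let vs : is_col_seq s. Proof. by move: sN; rewrite mem_col_seqs => /andP[]. Qed.

Lemma mem_col_ideal X : X \in col_ideal P s <->
  forall i j : 'I_n.+1, (nth 0 s j <= i)%N -> coord_mx P X i j = 0.
Proof.
split=> [/(mem_unit_span Pu) XS i j ij|XS]; first by apply: XS; rewrite inE /= -leqNgt.
by apply/(mem_unit_span Pu) => i j; rewrite inE /= -leqNgt => /XS.
Qed.

Lemma nth_col_seq_mono i j : (i <= j < n.+1)%N -> (nth 0 s i <= nth 0 s j)%N.
Proof.
case/andP=> ij jn; apply: (sorted_leq_nth leq_trans leqnn) => //; rewrite ?inE ?ss //.
- by case/andP: vs => + _; case: (s).
- exact: leq_ltn_trans ij jn.
Qed.

Lemma col_ideal_strict X : X \in col_ideal P s ->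
  forall i j : 'I_n.+1, (j <= i)%N -> coord_mx P X i j = 0.
Proof.
by move/mem_col_ideal => XS i j ji; apply: XS; exact: leq_trans (col_seq_nth j vs) ji.
Qed.

Lemma strict_ad_nilpotent X : (forall i j : 'I_n.+1, (j <= i)%N ->
  coord_mx P X i j = 0) ->
  ad_nilpotent X.
Proof.
move=> XS; exists (n + n.+1)%N => Y _.
(* Bracketing with X raises the superdiagonal index j - i by at least one. This index runs from -n
   to n, so 2n + 1 brackets leave nothing. *)
have it m : forall i j : 'I_n.+1, (j + n < i + m)%N -> coord_mx P (iter m (lie_bracket
  X) Y) i j = 0.
  elim: m => [|m IHm] i j ijm; first by have := ltn_ord i; lia.
  rewrite iterS (coord_mx_bracketE Pu); apply: big1 => k _.
  have [ki|ik] := leqP k i; first rewrite (XS i k) // mul0r.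
    have [jk|kj] := leqP j k; first by rewrite (XS k j) // mulr0 subr0.
    by rewrite IHm ?mul0r ?subr0 //; lia.
  rewrite (IHm k j) ?mulr0; last by lia.
  have [jk|kj] := leqP j k; first by rewrite (XS k j) // mulr0 subr0.
  by rewrite IHm ?mul0r ?subr0 //; lia.
apply: (coord_mx_inj Pu); rewrite linear0; apply/matrixP => i j; rewrite [RHS]mxE;
  apply: it.
have := ltn_ord j; lia.
Qed.

Lemma col_ideal_is_ideal : ad_nilpotent_ideal b (col_ideal P s).
Proof.
split; last by move=> X /col_ideal_strict /strict_ad_nilpotent.
  apply/subvP => X Xs; apply/hb; split; last by move=> i j /ltnW;
    exact: col_ideal_strict.
  by rewrite -(mxtrace_coord_mx Pu); apply: big1 => i _; rewrite (col_ideal_strict Xs).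
move=> X Y /hb[_ XU] /mem_col_ideal YS; apply/mem_col_ideal => i j ij;
  rewrite (coord_mx_bracketE Pu).
apply: big1 => k _; case: (ltnP k i) => ki.
  rewrite XU // mul0r; have [jk|kj] := ltnP j k; first by rewrite XU // mulr0 subrr.
  rewrite YS ?mul0r ?subrr //; apply: leq_trans ij; apply: nth_col_seq_mono.
  by rewrite kj ltn_ord.
rewrite (YS k j) ?mulr0 ?(leq_trans ij) //.
have [jk|kj] := ltnP j k; first by rewrite XU // mulr0 subrr.
rewrite YS ?mul0r ?subrr //; apply: leq_trans ij; apply: nth_col_seq_mono.
by rewrite kj ltn_ord.
Qed.

Lemma dim_col_ideal : \dim (col_ideal P s) = sumn s.
Proof.
rewrite dim_unit_span //.
have -> : #|[set q : 'I_n.+1 * 'I_n.+1 | (q.1 < nth 0 s q.2)%N]| =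
    \sum_(j < n.+1) #|[set i : 'I_n.+1 | (i < nth 0 s j)%N]|.
  under [RHS]eq_bigr => j _ do rewrite -sum1_card.
  rewrite -sum1_card [RHS](exchange_big_dep xpredT) //= [LHS](eq_bigl (fun q : 'I_n.+1
    * 'I_n.+1 => true && (q.1 < nth 0 s q.2)%N)); last first.
    by move=> q; rewrite inE.
  rewrite -(pair_big_dep xpredT (fun i j : 'I_n.+1 => i < nth 0 s j)%N (fun _ _ =>
    1%N)) /=.
  by apply: eq_bigr => i _; apply: eq_bigl => j; rewrite inE.
rewrite -[in RHS](mkseq_nth 0%N s) ss /mkseq sumnE big_map -/(index_iota 0 n.+1)
  big_mkord.
apply: eq_bigr => j _; apply: card_ord_lt; apply: leq_trans (col_seq_nth j vs) _.
exact: ltnW.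
Qed.

Lemma col_next_mono i j : (i <= j <= n.+1)%N -> (col_next s i <= col_next s j)%N.
Proof.
case/andP=> ij jn; rewrite /col_next; case: j ij jn => [|j] ij jn.
  by move: ij; rewrite leqn0 => /eqP ->.
by apply: nth_col_seq_mono; rewrite /= in jn *; lia.
Qed.

Lemma iter_col_next_mono m i j : (i <= j <= n.+1)%N ->
  (iter m (col_next s) i <= iter m (col_next s) j)%N.
Proof.
elim: m => [|m IHm] ij; first by case/andP: ij.
rewrite !iterS; apply: col_next_mono; rewrite IHm //=.
by have := iter_col_next_le m j vs; move: ij; lia.
Qed.

(** An entry of a bracket passes through an intermediate index k, so the bounds for the two factors
    compose. Both terms of the bracket give the same bound because the iterates of [col_next]
    commute and are monotone. *)
Lemma ideal_pow_col_ideal m : ideal_pow (col_ideal P s) m.+1 =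
  unit_span P [set q : 'I_n.+1 * 'I_n.+1 | (q.1 < iter m.+1 (col_next s) q.2.+1)%N].
Proof.
rewrite /ideal_pow /=; elim: m => [|m IHm]; first by [].
rewrite [LHS]/= IHm; apply/eqP; rewrite eqEsubv; apply/andP; split.
  apply: lie_prod_sub => X Y /(mem_unit_span Pu) XS /mem_col_ideal YS.
  apply/(mem_unit_span Pu) => i j; rewrite inE /= -leqNgt => ij;
    rewrite (coord_mx_bracketE Pu).
  apply: big1 => k _.
  have -> : coord_mx P X i k * coord_mx P Y k j = 0.
    have [kj|jk] := ltnP k (nth 0 s j); last by rewrite YS ?mulr0.
    rewrite XS ?mul0r // inE -leqNgt /=; apply: leq_trans ij.
    rewrite -!iterS [X in (_ <= X)%N]iterSr; apply: iter_col_next_mono;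
      rewrite /col_next /= kj /=.
    by have := col_seq_nth j vs; have := ltn_ord j; lia.
  have [ik|ki] := ltnP i (nth 0 s k); last by rewrite YS ?mul0r ?subrr.
  rewrite XS ?mulr0 ?subrr // inE -leqNgt /=; rewrite leqNgt; apply/negP => kj.
  move: ij; rewrite leqNgt => /negP; apply;
    rewrite -[X in (_ < X)%N]/(col_next s (iter m.+1 (col_next s) j.+1)).
  apply: leq_trans ik _; rewrite -[nth 0 s k]/(col_next s k.+1); apply: col_next_mono.
  by rewrite kj /=; have := iter_col_next_le m.+1 j.+1 vs; have := ltn_ord j;
    rewrite /=; lia.
apply/span_subvP => Y /mapP[[i j]]; rewrite mem_enum inE /= => ij ->.
(* The largest row index available in column j: by monotonicity it gives the weakest bound on i, and
   l + 1 = [col_next s j.+1] makes the iterates match. *)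
pose l := (nth 0 s j).-1.
have sj := col_seq_nth j vs.
have sj0 : (0 < nth 0 s j)%N.
  rewrite lt0n; apply/eqP => s0; move: ij; rewrite -!iterS iterSr.
  rewrite (_ : col_next s j.+1 = 0%N) //.
  by have := iter_col_next_le m.+1 0 vs; rewrite sub0n leqn0 => /eqP ->.
have ln : (l < n.+1)%N
  by apply: leq_ltn_trans (leq_pred _) _; exact: leq_ltn_trans sj (ltn_ord j).
have l1 : l.+1 = nth 0%N s j by rewrite /l prednK.
have ijlt : (i < j)%N.
  have := leq_trans ij (iter_col_next_le m.+2 j.+1 vs); rewrite subSS => /leq_trans;
    apply.
  exact: leq_subr.
have -> : unit_vec P i j = lie_bracket (unit_vec P i (Ordinal ln)) (unit_vec P (Ordinal
  ln) j).
  rewrite unit_vec_bracket // eqxx scale1r -[j == i]val_eqE gtn_eqF // scale0r.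
  by rewrite subr0.
apply: mem_lie_prod; apply: unit_vec_span => //; rewrite inE /=; last by rewrite -l1.
by move: ij; rewrite -!iterS iterSr l1.
Qed.

(** Monotonicity of the iterates puts the corner position (0, n) in every nonzero power, so only the
    last column has to be tested. *)
Lemma ideal_pow_col_ideal_eq0 m :
  (ideal_pow (col_ideal P s) m.+1 = 0%VS) <-> iter m.+1 (col_next s) n.+1 = 0%N.
Proof.
rewrite ideal_pow_col_ideal; split=> [S0|S0].
  apply/eqP; rewrite -leqn0 leqNgt; apply/negP => it0.
  have : unit_vec P ord0 ord_max \in unit_span P [set q : 'I_n.+1 * 'I_n.+1 | (q.1 <
    iter m.+1 (col_next s) q.2.+1)%N].
    by apply: unit_vec_span => //; rewrite inE.
  rewrite S0 memv0 => /eqP/(congr1 (coord_mx P)); rewrite coord_mx_unit_vec // linear0.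
  by move/matrixP/(_ ord0 ord_max)/eqP; rewrite !mxE !eqxx oner_eq0.
apply/eqP; rewrite -dimv_eq0 dim_unit_span // cards_eq0; apply/eqP/setP => q.
rewrite !inE; apply/negbTE; rewrite -leqNgt.
by have := @iter_col_next_mono m.+1 q.2.+1 n.+1;
  rewrite ltn_ord leqnn S0 => /(_ isT); rewrite leqn0 => /eqP ->.
Qed.

Lemma nilpotence_class_col_ideal k : nilpotence_class (col_ideal P s) k <->
  has_class s k.
Proof.
have it0 m k' : (m <= k')%N -> iter m (col_next s) n.+1 =
  0%N -> iter k' (col_next s) n.+1 = 0%N.
  move=> mk i0; rewrite -(subnK mk) iterD i0; apply/eqP; rewrite -leqn0.
  by have := iter_col_next_le (k' - m) 0 vs.
rewrite /has_class ss; split=> [[/ideal_pow_col_ideal_eq0 k0 kmin]|/andP[/eqP k1 /eqP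
  k0]].
  rewrite k0 eqxx andbT; case: k k0 kmin => // k _ kmin;
    apply/eqP => /ideal_pow_col_ideal_eq0/kmin.
  by rewrite ltnn.
split; first exact/ideal_pow_col_ideal_eq0.
move=> m /ideal_pow_col_ideal_eq0 m0; rewrite leqNgt; apply/negP => mk; apply: k1.
exact: it0 mk m0.
Qed.

End IdealOfSeq.

Lemma col_ideal_inj (F : numClosedFieldType) n (P : 'M[F]_n.+1) : P \in unitmx ->
  {in col_seqs n.+1 &, injective (col_ideal P)}.
Proof.
move=> Pu s t sN tN st.
have lenN u : u \in col_seqs n.+1 -> size u = n.+1 /\ is_col_seq u.
  by rewrite mem_col_seqs => /andP[/eqP].
have [[ss vs] [st' vt]] := (lenN s sN, lenN t tN).
have half u v (j : 'I_n.+1) : is_col_seq v -> col_ideal P u =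
  col_ideal P v -> (nth 0 v j <= nth 0 u j)%N.
  move=> vv uv; rewrite leqNgt; apply/negP => uvj.
  have uN : (nth 0 u j < n.+1)%N.
    exact: leq_trans uvj (leq_trans (col_seq_nth j vv) (ltnW (ltn_ord j))).
  have : unit_vec P (Ordinal uN) j \in col_ideal P v by apply: unit_vec_span;
    rewrite inE.
  rewrite -uv => /(mem_unit_span Pu)/(_ (Ordinal uN) j);
    rewrite inE /= ltnn => /(_ isT).
  by rewrite coord_mx_unit_vec // mxE !eqxx => /eqP; rewrite oner_eq0.
apply: (@eq_from_nth _ 0%N) => [|j]; rewrite ss ?st' // => jn.
by apply/eqP; rewrite eqn_leq (half t s (Ordinal jn)) ?(half s t (Ordinal jn)).
Qed.

(** * Generating functions *)

(** The search range suffices because the class is smaller than the size, see [has_class_lt]. *)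
Definition seq_class (s : seq nat) : nat := find (has_class s) (iota 0 (size s)).

Lemma has_classE N s k : s \in col_seqs N.+1 -> has_class s k = (seq_class s == k).
Proof.
rewrite mem_col_seqs => /andP[/eqP ss vs].
have it0 m l : (m <= l)%N -> iter m (col_next s) (size s) = 0%N ->
    iter l (col_next s) (size s) = 0%N.
  move=> ml i0; rewrite -(subnK ml) iterD i0; apply/eqP; rewrite -leqn0.
  by have := iter_col_next_le (l - m) 0 vs.
have uniq_cls k1 k2 : has_class s k1 -> has_class s k2 -> (k1 <= k2)%N.
  move=> /andP[/eqP k1n _] /andP[_ /eqP k2z]; rewrite leqNgt; apply/negP => lt.
  by apply: k1n; exact: it0 lt k2z.
have [c cP] : exists c, has_class s c.
  have ex : exists m, iter m.+1 (col_next s) (size s) == 0%N.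
    exists N; rewrite -leqn0; have := iter_col_next_le N.+1 (size s) vs.
    by rewrite ss subnn.
  case: (ex_minnP ex) => c c0 cmin; exists c; rewrite /has_class c0 andbT.
  by case: c c0 cmin => [|c] _ cmin; [rewrite ss | apply/negP => /cmin; rewrite ltnn].
have hs : has (has_class s) (iota 0 (size s)).
  by apply/hasP; exists c; rewrite // mem_iota /=; exact: has_class_lt cP.
have clsP : has_class s (seq_class s).
  have := nth_find 0%N hs; rewrite nth_iota ?add0n //.
  by move: hs; rewrite has_find size_iota.
apply/idP/eqP => [kP|<-//]; apply/eqP; rewrite eqn_leq.
by rewrite !uniq_cls.
Qed.

Lemma seq_class_lt N s : s \in col_seqs N.+1 -> (seq_class s < N.+1)%N.
Proof.
move=> sN; have := has_classE (seq_class s) sN; rewrite eqxx.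
by move: sN; rewrite mem_col_seqs => /andP[/eqP <- vs]; apply: has_class_lt.
Qed.

(** The outer variable is q and the inner one is t: [map_poly (horner_eval 1)] sets t = 1, and
    evaluation at 1 sets q = 1. *)
Definition nilp_gf (N : nat) : {poly {poly rat}} :=
  \sum_(s <- col_seqs N) ('X^(sumn s) : {poly rat}) *: 'X^(seq_class s).

Lemma nilp_gf_coef N d k : (nilp_gf N.+1)`_k`_d =
  (size [seq s <- col_seqs N.+1 | (sumn s == d) && has_class s k])%:R.
Proof.
rewrite /nilp_gf coef_sum coef_sum size_filter -sum1_count natr_sum [RHS]big_mkcond.
apply: eq_big_seq => s sN; rewrite coefZ coefXn (has_classE _ sN).
by rewrite [k == _]eq_sym; case: (_ == k); rewrite ?mulr1 ?mulr0 ?andbF ?coef0 //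
  coefXn eq_sym andbT; case: eqP.
Qed.

Lemma nilp_gf_chain n : nilp_gf n.+1 =
  \sum_(0 <= k < n.+1)
    (\sum_(s : k.+2.-tuple 'I_n.+2 | is_chain s) chain_weight s) *: 'X^k.
Proof.
rewrite /nilp_gf.
transitivity (\sum_(0 <= k < n.+1) \sum_(s <- col_seqs n.+1 | has_class s k)
    ('X^(sumn s) : {poly rat}) *: 'X^k : {poly {poly rat}}).
  under [RHS]eq_bigr => k _ do rewrite big_mkcond.
  rewrite exchange_big; apply: eq_big_seq => s sN /=.
  rewrite (bigD1_seq (seq_class s)) ?iota_uniq ?mem_index_iota ?seq_class_lt //=.
  rewrite (has_classE _ sN) eqxx big1 ?addr0 // => k; rewrite (has_classE _ sN) eq_sym.
  by move/negPf ->.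
apply: eq_bigr => k _; rewrite sum_chain_weight -scaler_suml; congr (_ *: _).
have := @sum_col_seqs_chain_seqs k n.+1 (fun=> 1) isT.
by under eq_bigr do rewrite mulr1; under [X in _ = X -> _]eq_bigr do rewrite mulr1.
Qed.

(** Coefficient by coefficient this is [sum_height_seqs_col_seqs] with [phi] constantly 1. The shift
    by 1 in the exponent arises because an up step from x ends at x + 1. *)
Lemma nilp_gf_height n : map_poly (horner_eval 1) (nilp_gf n.+1) =
  \sum_(p : (2 * n + 2).-tuple bool | dyck p) 'X^(height p - 1).
Proof.
rewrite (sum_dyck _ (fun p => 'X^(height p - 1))).
transitivity (\sum_(s <- col_seqs n.+1) 'X^(seq_class s) : {poly rat}).
  rewrite /nilp_gf rmorph_sum; apply: eq_bigr => s _ /=.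
  by rewrite map_polyZ map_polyXn /= /horner_eval hornerXn expr1n scale1r.
have heightE c : c \in height_seqs n.+1 -> (height (height_word 0 c) - 1)%N = max_seq c.
  rewrite mem_height_seqs => /andP[/eqP sc /height_wordK[dc hc _]].
  by rewrite height_up_heights ?dyckE ?hc ?sc // subn1.
apply/polyP => k; rewrite !coef_sum.
transitivity ((\sum_(s <- col_seqs n.+1 | has_class s k) 1)%N%:R : rat).
  rewrite natr_sum [RHS]big_mkcond; apply: eq_big_seq => s sN.
  by rewrite coefXn (has_classE _ sN) eq_sym; case: eqP.
rewrite -(@sum_height_seqs_col_seqs k n.+1 (fun=> 1%N)) // natr_sum [LHS]big_mkcond.
by apply: eq_big_seq => c cN; rewrite coefXn heightE // eq_sym; case: eqP.
Qed.

(** By [area_up_heights] the area is (n + 1) / 2 plus the sum of the up-step ordinates, and (n +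
    1)^2 / 2 - (n + 1) / 2 is C(n + 1, 2). The natural subtraction defining w is exact by
    [sumn_heights], and its value is the dimension of the ideal. *)
Lemma nilp_gf_area n : exists w : (2 * n + 2).-tuple bool -> nat,
  (forall p : (2 * n + 2).-tuple bool, dyck p ->
     (w p)%:R = (n.+1 ^ 2)%:R / 2 - area p) /\
  (nilp_gf n.+1).[1] = \sum_(p : (2 * n + 2).-tuple bool | dyck p) 'X^(w p).
Proof.
pose w (p : seq bool) := ('C(n.+1, 2) - sumn (up_heights 0 p))%N.
have csE s : s \in col_seqs n.+1 -> (sumn (heights s) + sumn s)%N = 'C(n.+1, 2).
  by rewrite mem_col_seqs => /andP[/eqP <- /sumn_heights].
exists (fun p => w p); split=> [p pd|].
  have [pv pE] := up_heightsK (etrans (esym (dyckE p)) pd).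
  have sp : size (up_heights 0 p) = n.+1.
    by have [_ _] := height_wordK pv; rewrite pE size_tuple; lia.
  have : up_heights 0 p \in height_seqs n.+1 by rewrite mem_height_seqs sp eqxx.
  case/mapP => s sN hE.
  rewrite area_up_heights // sp /w natrB; last by rewrite hE -(csE _ sN) leq_addr.
  have -> : ('C(n.+1, 2))%:R = n.+1%:R * n%:R / 2 :> rat.
    by rewrite bin2 /= -natrM -[in RHS](odd_double_half (n.+1 * n)) oddM /= andNb add0n
      -muln2 natrM mulfK.
  by rewrite natrX -natr1; field.
rewrite (sum_dyck _ (fun p => 'X^(w p))) big_map /nilp_gf horner_sum.
apply: eq_big_seq => s sN; rewrite hornerZ hornerXn expr1n mulr1.
have /height_wordK[_ cE _] : is_height_seq (heights s).
  by move: sN; rewrite mem_col_seqs => /andP[_ /heights_is_height_seq[]].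
by rewrite /w cE -(csE _ sN) addKn.
Qed.

Theorem theorem6p1 (R : realType) (n : nat) (n_ge1 : (1 <= n)%N)
    (h : {vspace 'M[R[i]]_n.+1}) (h_cartan : cartan_subalgebra h)
    (Pos : seq 'Hom(subvs_of h, R[i]^o)) (Pos_pos : positive_system Pos) :
  finite_set [set I | ad_nilpotent_ideal (borel Pos) I]%classic /\
  exists C : {poly {poly rat}},
  [/\ forall d k : nat, C`_k`_d = (num_ideals (borel Pos) d k)%:R,
      C = \sum_(0 <= k < n.+1)
            (\sum_(s : k.+2.-tuple 'I_n.+2 | is_chain s) chain_weight s)
              *: 'X^k,
      map_poly (horner_eval 1) C =
        \sum_(p : (2 * n + 2).-tuple bool | dyck p) 'X^(height p - 1)
    & exists w : (2 * n + 2).-tuple bool -> nat,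
        (forall p : (2 * n + 2).-tuple bool, dyck p ->
           (w p)%:R = (n.+1 ^ 2)%:R / 2 - area p) /\
        C.[1] = \sum_(p : (2 * n + 2).-tuple bool | dyck p) 'X^(w p)].
Proof.
have [P0 P0u hP] := cartan_diag h_cartan.
have [P Pu bP] := borel_upper P0u hP Pos_pos.
have idealP I : ad_nilpotent_ideal (borel Pos) I <->
    I \in [seq col_ideal P s | s <- col_seqs n.+1].
  split=> [/(ideal_col_seq Pu bP)[s sN ->]|/mapP[s sN ->]]; first exact: map_f.
  exact: col_ideal_is_ideal.
split.
  apply: (@sub_finite_set _ _ [set` [seq col_ideal P s | s <- col_seqs n.+1]]%classic).
    by move=> I /idealP.
  exact: finite_seq.
exists (nilp_gf n.+1); split.
- move=> d k; rewrite nilp_gf_coef; congr _%:R; rewrite /num_ideals.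
  set L := [seq s <- _ | _].
  (* Once the set is the coercion of an explicit finite set, [fset_set] can be computed;
     [col_ideal_inj] then makes its cardinal the length of L. *)
  have -> : ideals_of (borel Pos) d k = [set` [fset I in [seq col_ideal P s | s <- L]]%fset]%classic.
    apply/seteqP; split=> I /=.
      case=> /idealP/mapP[s sN ->]; rewrite (dim_col_ideal Pu sN) => sd /(nilpotence_class_col_ideal Pu sN) sk.
      by rewrite in_fset /= map_f // mem_filter sd eqxx sk.
    rewrite in_fset /= => /mapP[s]; rewrite mem_filter => /andP[/andP[/eqP sd sk] sN] ->.
    split; [exact: col_ideal_is_ideal | by rewrite (dim_col_ideal Pu sN) | exact/nilpotence_class_col_ideal].
  rewrite set_fsetK card_fseq undup_id ?size_map // map_inj_in_uniq.
    by rewrite filter_uniq ?col_seqs_uniq.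
  move=> s t; rewrite !mem_filter => /andP[_ sN] /andP[_ tN]; exact: (col_ideal_inj Pu).
- exact: nilp_gf_chain.
- exact: nilp_gf_height.
- exact: nilp_gf_area.
Qed.
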